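(* Let $d\ge1$ and $m\ge 2$ be fixed integers, and let $\mathbf{X}=(X_1,\dots,X_d)$ be a random vector in $\mathbb{R}^d$ with continuous marginal distributions and globally (mutually) independent components. For $n>m$, let $$T=T_n=m^d\sum_{\mathbf{r}\in\{1,\dots,m\}^d}\bigl(\hat P_n(\mathbf{r})-P(\mathbf{r},c_0)\bigr)^2 .$$ Set $$S_1=\frac{m\,4^{m-1}}{(2m-1)\binom{2m-2}{m-1}},\qquad S_2=\frac{m^2\binom{4m-3}{2m-2}}{\left((2m-1)\binom{2m-2}{m-1}\right)^2}.$$ Then, as the sample size $n\to\infty$, $$\begin{aligned} n^2\,\mathrm{Var}(T_n)\;\longrightarrow\;& 2S_2^d-2m^4+2(m-1)^4\left(\frac{m^4-4m^3+6m^2-4m+S_2}{(m-1)^4}\right)^{d}\\ &+12(m-1)^2\left(\frac{m^2-2m+S_2}{(m-1)^2}\right)^{d}+8(m-1)\left(\frac{m-S_2}{m-1}\right)^{d}\\ &+8(m-1)^3\left(\frac{m^3-3m^2+3m+S_2}{(m-1)^3}\right)^{d}, \end{aligned}$$ and $$n\,\mathbb{E}(T_n)\;\longrightarrow\; S_1^d-m^2+(m-1)^2\left(\frac{m^2-2m+S_1}{(m-1)^2}\right)^d+2(m-1)\left(\frac{m-S_1}{m-1}\right)^d .$$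
   Context: Let $\mathbf{X}(1),\dots,\mathbf{X}(n)$ be an $n$-sample (i.i.d. copies) of $\mathbf{X}$. For a subset $S\subset\{1,\dots,n\}$ with $|S|=m$, consider the sub-sample $(\mathbf{X}(i))_{i\in S}$. The rank vector of observation $i\in S$ within the sub-sample is $(R_1,\dots,R_d)\in\{1,\dots,m\}^d$, where $R_l$ is the rank (in increasing order) of the $l$-th component $X_l(i)$ among $\{X_l(j): j\in S\}$; since the marginals are continuous, there are almost surely no ties. For $\mathbf{r}\in\{1,\dots,m\}^d$, let $B_{\mathbf{r}}(S)=1$ if some observation $i\in S$ has rank vector equal to $\mathbf{r}$ within the sub-sample, and $B_{\mathbf{r}}(S)=0$ otherwise. Define $$\hat P_n(\mathbf{r})=\frac{1}{m\binom{n}{m}}\sum_{S\subset\{1,\dots,n\},\,|S|=m}B_{\mathbf{r}}(S),\qquad P(\mathbf{r},c_0)=\frac1m\,\mathbb{E}\bigl[B_{\mathbf{r}}(\{1,\dots,m\})\bigr],$$ where $c_0$ stands for any distribution of $\mathbf{X}$ with globally independent components, and the expectation defining $P(\mathbf{r},c_0)$ is taken under $c_0$ (in which case $P(\mathbf{r},c_0)=m^{-d}$). The expectation and variance of $T_n$ are taken under this independence assumption.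
   Formalization: In the last term of the variance limit the sign of S_2 is corrected to (m^3-3m^2+3m-S_2)/(m-1)^3; with the printed plus sign the limit for d=1 would be 16 S_2 > 0, although T_n = 0 almost surely. *)

(* Defs.v *)
From HB Require Import structures.
From mathcomp Require Import all_boot all_order all_algebra.
From mathcomp Require Import all_classical all_reals all_analysis.

Set Implicit Arguments.
Unset Strict Implicit.
Unset Printing Implicit Defensive.

Import Order.TTheory GRing.Theory Num.Theory.
Import numFieldNormedType.Exports.

Local Open Scope classical_set_scope.
Local Open Scope ring_scope.

Section probabilistic_notions.
Context (dT : measure_display) (T : measurableType dT) (R : realType)
  (P : probability T R).

Definition mutually_independent (dE : measure_display) (E : measurableType dE)
    (I : finType) (X : I -> {RV P >-> E}) : Prop :=
  forall (J : {set I}) (A : I -> set E),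
    (forall i, i \in J -> measurable (A i)) ->
    P (\bigcap_(i in [set` J]) (X i @^-1` A i)) =
    (\prod_(i in J) P (X i @^-1` A i))%E.

Definition component (d : nat) (X : {RV P >-> d.-tuple R}) (l : 'I_d) : T -> R :=
  fun w => tnth (X w) l.

Lemma measurable_component d (X : {RV P >-> d.-tuple R}) (l : 'I_d) :
  measurable_fun [set: T] (component X l).
Proof.
exact: (measurableT_comp (measurable_tnth l) (measurable_funPT X)).
Qed.

HB.instance Definition _ d (X : {RV P >-> d.-tuple R}) (l : 'I_d) :=
  isMeasurableFun.Build _ _ _ _ (component X l) (measurable_component X l).

Definition component_RV d (X : {RV P >-> d.-tuple R}) (l : 'I_d) :
  {RV P >-> R} := component X l.

Definition continuous_marginals d (X : {RV P >-> d.-tuple R}) : Prop :=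
  forall l : 'I_d, continuous (cdf (component_RV X l)).

Definition independent_components d (X : {RV P >-> d.-tuple R}) : Prop :=
  mutually_independent (component_RV X).

End probabilistic_notions.

(* [Y] is a sample of i.i.d. copies of [X]; it may live on another probability
   space. Laws are compared on measurable sets only, since [distribution] is
   also defined (without any meaning) on the other ones. *)
Definition iid_copies (dT0 dT dE : measure_display) (T0 : measurableType dT0)
    (T : measurableType dT) (E : measurableType dE) (R : realType)
    (P0 : probability T0 R) (P : probability T R) (X : {RV P0 >-> E})
    (n : nat) (Y : 'I_n -> {RV P >-> E}) : Prop :=
  mutually_independent Y /\
  forall (i : 'I_n) (A : set E), measurable A ->
    distribution P (Y i) A = distribution P0 X A.

Section rank_statistics.
Context (R : realType) (d m n : nat).
Implicit Types (x : 'I_n -> d.-tuple R) (S : {set 'I_n})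
  (r : {ffun 'I_d -> 'I_m}).

(* In the absence of ties, this is the rank, in {1, ..., #|S|}, of the [l]-th
   component of observation [i] of [S] within the sub-sample [S]. *)
Definition rank x S (i : 'I_n) (l : 'I_d) : nat :=
  #|[pred j in S | tnth (x j) l <= tnth (x i) l]|.

(* A vector of {1, ..., m}^d is encoded by [r] with values in 'I_m, the actual
   [l]-th coordinate being [(r l).+1]. *)
Definition B x S r : R :=
  [exists i in S, [forall l, rank x S i l == (r l).+1]]%:R.

Definition Phat x r : R :=
  (m%:R * 'C(n, m)%:R)^-1 * \sum_(S : {set 'I_n} | #|S| == m) B x S r.

End rank_statistics.

(* P(r, c_0); [Y] is a sample of size exactly [m]. *)
Definition P_c0 (R : realType) (d m : nat) (dT : measure_display)
    (T : measurableType dT) (P : probability T R)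
    (Y : 'I_m -> {RV P >-> d.-tuple R}) (r : {ffun 'I_d -> 'I_m}) : R :=
  m%:R^-1 * fine 'E_P[fun w => B (fun i => Y i w) finset.setT r].

Definition T_stat (R : realType) (d m n : nat) (p : {ffun 'I_d -> 'I_m} -> R)
    (x : 'I_n -> d.-tuple R) : R :=
  m%:R ^+ d * \sum_(r : {ffun 'I_d -> 'I_m}) (Phat x r - p r) ^+ 2.

Definition S1 (R : realType) (m : nat) : R :=
  (m * 4 ^ (m - 1))%:R / ((2 * m - 1) * 'C(2 * m - 2, m - 1))%:R.

Definition S2 (R : realType) (m : nat) : R :=
  (m ^ 2 * 'C(4 * m - 3, 2 * m - 2))%:R /
  (((2 * m - 1) * 'C(2 * m - 2, m - 1)) ^ 2)%:R.

Section limits.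
Context (R : realType) (d m : nat).
Let M : R := m%:R.
Let s1 : R := S1 R m.
Let s2 : R := S2 R m.

(* The numerator of the last term is [(M - 1) ^+ 3 - (s2 - 1)]: [s2] comes with
   a minus sign, as in the other term of odd degree. In particular the whole
   expression vanishes for [d = 1], as it has to, since then the statistic is
   almost surely zero. *)
Definition lim_var : R :=
  2 * s2 ^+ d - 2 * M ^+ 4
  + 2 * (M - 1) ^+ 4 *
    ((M ^+ 4 - 4 * M ^+ 3 + 6 * M ^+ 2 - 4 * M + s2) / (M - 1) ^+ 4) ^+ d
  + 12 * (M - 1) ^+ 2 * ((M ^+ 2 - 2 * M + s2) / (M - 1) ^+ 2) ^+ d
  + 8 * (M - 1) * ((M - s2) / (M - 1)) ^+ d
  + 8 * (M - 1) ^+ 3 *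
    ((M ^+ 3 - 3 * M ^+ 2 + 3 * M - s2) / (M - 1) ^+ 3) ^+ d.

Definition lim_mean : R :=
  s1 ^+ d - M ^+ 2
  + (M - 1) ^+ 2 * ((M ^+ 2 - 2 * M + s1) / (M - 1) ^+ 2) ^+ d
  + 2 * (M - 1) * ((M - s1) / (M - 1)) ^+ d.

End limits.

(* Main.v *)
From HB Require Import structures.
Require Import Defs.
From mathcomp Require Import all_classical all_reals all_analysis.
From mathcomp Require Import measurable_realfun.
From mathcomp Require Import all_boot all_order all_algebra all_fingroup.
From mathcomp Require Import ring lra zify.

Set Implicit Arguments.
Unset Strict Implicit.
Unset Printing Implicit Defensive.

Import Order.TTheory GRing.Theory Num.Theory.
Import numFieldNormedType.Exports.

Local Open Scope ring_scope.

(** The statistic only sees, for each coordinate, the order of the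
    observations.  Without ties (an almost sure event, because the marginals
    have no atom) and with independent coordinates, permuting the observations
    of each coordinate separately does not change the law of the sample, so the
    expectation of any function of the order is its mean over all these
    permutations of one arbitrary sample without ties ([expectation_local]).
    The rest is finite combinatorics.

    Let m be the size of the subsets, a = m - 1, and let phi_S(r) be the
    centered indicator that the cell r is occupied in the sub-sample S.  Up to
    the factor m^(d-2), the statistic is the sum over r of the squared average
    of phi_S(r) over S, so that its first two moments are averages over S1, S2,
    and over S1, ..., S4, of means of products of phi's.  Functions of the order
    on disjoint sets of observations are independent ([smean_indep]).  Hence
    such a product has mean zero as soon as one of the sets is disjoint from all
    others, and the pairs and quadruples of sets which contribute to the leading
    order are those where the sets are paired and the two members of a pair
    share exactly one observation; everything else weighs O(1/n^2), respectively
    O(1/n^3) ([avg_moment2_bound], [avg_moment4_bound]).  If C(r,r') is the mean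
    of phi_S(r) phi_S'(r') for two sets sharing one observation, a pair meets in
    one observation with probability about m^2/n, and therefore n E(T) tends to
    m^d times the sum of C(r,r); in the second moment, the pairing of each cell
    with itself cancels against the squared mean, and the two other pairings
    leave 2 m^(2d) times the sum of the C(r,r')^2 as the limit of n^2 Var(T).

    It remains to compute C(r,r').  The coordinates being independent, it is a
    combination of products over the coordinates of the joint laws of the ranks
    of one observation of S and one of S' ([smean_BB]); they all follow by
    symmetry from the law q of the two ranks of the common observation
    ([joint_belowE]).  Sums of products over cells become d-th powers of sums
    over ranks, and the sums of q(k,k) and of q(k,k')^2 are evaluated by the
    convolution identities [sum_central_bin] and [sum_sqr_bin_bin]. *)

(** * Two binomial convolutions *)

(** Reversing the summation order exchanges the weights i and N - i.  This is
    what the rule (f * f)' = 2 f' f for formal power series says on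
    coefficients: it turns a linear recurrence for f, with coefficients of
    degree one in the index, into one for its self-convolution. *)
Lemma double_weighted_convolution (A : comPzRingType) (f : nat -> A) (N : nat) :
  (\sum_(i < N.+1) i%:R * (f i * f (N - i)%N)) *+ 2 =
  N%:R * \sum_(i < N.+1) f i * f (N - i)%N.
Proof.
rewrite mulr2n {2}(reindex_inj rev_ord_inj) -big_split mulr_sumr /=.
apply: eq_bigr => i _; rewrite subSS subKn -1?ltnS//.
by rewrite [f (N - i)%N * _]mulrC -mulrDl -natrD subnKC -1?ltnS.
Qed.

Lemma central_bin_rec (k : nat) :
  (k.+1 * 'C(2 * k.+1, k.+1) = 2 * (2 * k).+1 * 'C(2 * k, k))%N.
Proof.
have e1 := mul_bin_diag (2 * k).+2 k.
have e3 := mul_bin_diag (2 * k).+1 k.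
have -> : (2 * k.+1 = (2 * k).+2)%N by lia.
rewrite -e1 /=.
have -> : 'C((2 * k).+1, k) = 'C((2 * k).+1, k.+1).
  rewrite -(bin_sub (_ : k.+1 <= (2 * k).+1)%N); last by lia.
  by congr 'C(_, _); lia.
have -> : ((2 * k).+2 = 2 * k.+1)%N by lia.
by rewrite -mulnA -e3 mulnA.
Qed.

Lemma natr_int_inj (m n : nat) : m%:R = n%:R :> int -> m = n.
Proof. by rewrite !natz => -[]. Qed.

(** The generating function of the central binomial coefficients is
    (1 - 4x)^(-1/2), whose square is geometric. *)
Lemma sum_central_bin (a : nat) :
  (\sum_(k < a.+1) 'C(2 * k, k) * 'C(2 * (a - k), a - k) = 4 ^ a)%N.
Proof.
pose c k : int := 'C(2 * k, k)%:R.
suff E : \sum_(k < a.+1) c k * c (a - k)%N = 4 ^+ a.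
  apply: natr_int_inj; rewrite natr_sum natrX -[RHS]E.
  by apply: eq_bigr => k _; rewrite /c -natrM.
elim: a => [|a IH]; first by rewrite big_ord1.
apply: (@mulfI _ a.+1%:R); first by rewrite pnatr_eq0.
rewrite -double_weighted_convolution big_ord_recl mul0r add0r.
rewrite (eq_bigr (fun i : 'I_a.+1 =>
   4 * (i%:R * (c i * c (a - i)%N)) + 2 * (c i * c (a - i)%N))); last first.
  move=> i _; rewrite lift0 subSS mulrA.
  have -> : i.+1%:R * c i.+1 = 2 * (2 * i%:R + 1) * c i.
    by rewrite /c -natrM central_bin_rec -[(2 * i).+1]addn1 !(natrM, natrD).
  ring.
rewrite big_split /= -!mulr_sumr mulrnDl -mulrnAr double_weighted_convolution.
by rewrite IH exprS -natr1; ring.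
Qed.

(** These are, up to a change of variable, the Legendre polynomials:
    (1 - X)^p P_p((1 + X)/(1 - X)). *)
Definition sqbin_poly (p : nat) : {poly int} := \poly_(i < p.+1) ('C(p, i) ^ 2)%:R.

Lemma coef_sqbin_poly p i : (sqbin_poly p)`_i = 'C(p, i)%:R ^+ 2.
Proof.
by rewrite coef_poly natrX; case: ltnP => // h; rewrite bin_small // expr0n.
Qed.

(** The three-term recurrence of the Legendre polynomials.  On coefficients, it
    relates the neighbours u, v, w in one row of Pascal's triangle and amounts
    to the quadratic relation p v^2 = uv + vw + (p + 2) uw. *)
Lemma sqbin_poly_rec p :
  p.+2%:R * sqbin_poly p.+2 =
  (2 * p + 3)%:R * ((1 + 'X) * sqbin_poly p.+1)
  - p.+1%:R * ((1 - 'X) ^+ 2 * sqbin_poly p).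
Proof.
have e q : (1 - 'X) ^+ 2 * q = q - ('X * q) *+ 2 + 'X * ('X * q) :> {poly int}.
  by ring.
have eC (k : nat) (q : {poly int}) i : (k%:R * q)`_i = k%:R * q`_i.
  by rewrite mulr_natl coefMn mulr_natl.
rewrite e [(1 + _) * _]mulrDl mul1r; apply/polyP => i.
rewrite !(coefB, eC, coefD, coefMn, coefXM, coef_sqbin_poly).
have eS k : (k.+1 == 0%N) = false by [].
case: i => [|[|i]]; rewrite ?eqxx ?[_.+2.-1]/= ?[_.+1.-1]/= ?eS; cbv match.
- by rewrite !bin0; ring.
- by rewrite !bin0 !bin1; ring.
rewrite !binS !natrD.
have E1 : (i%:R + 2) * 'C(p, i.+2)%:R = (p%:R - i%:R - 1) * 'C(p, i.+1)%:R :> int.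
  have := mul_bin_left p i.+1; case: (leqP i.+1 p) => h.
    by move/(congr1 (fun n : nat => n%:R : int)); rewrite !natrM natrB // => H; lia.
  by move=> _; rewrite !bin_small ?mulr0//; lia.
have E2 : (i%:R + 1) * 'C(p, i.+1)%:R = (p%:R - i%:R) * 'C(p, i)%:R :> int.
  have := mul_bin_left p i; case: (leqP i p) => h.
    by move/(congr1 (fun n : nat => n%:R : int)); rewrite !natrM natrB // => H; lia.
  by move=> _; rewrite !bin_small ?mulr0//; lia.
move: E1 E2.
set u : int := 'C(p, i.+2)%:R; set v : int := 'C(p, i.+1)%:R; set w : int := 'C(p, i)%:R.
move=> E1 E2.
have E3 : p%:R * v ^+ 2 = u * v + v * w + (p%:R + 2) * (u * w).
  apply/eqP; rewrite -subr_eq0; apply/eqP.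
  transitivity ((u + v) * ((i%:R + 1) * v - (p%:R - i%:R) * w)
     - (v + w) * ((i%:R + 2) * u - (p%:R - i%:R - 1) * v)); first by ring.
  by rewrite E1 E2 !subrr !mulr0 subr0.
set r := (X in _ = X); set l := (X in X = _).
suff : l - r = 2 * (u * v + v * w + (p%:R + 2) * (u * w) - p%:R * v ^+ 2).
  by rewrite E3 subrr mulr0 => /eqP; rewrite subr_eq0 => /eqP.
rewrite /l /r; ring.
Qed.

Definition sqbin_conv (N : nat) : {poly int} :=
  \sum_(i < N.+1) sqbin_poly i * sqbin_poly (N - i)%N.

Lemma sqbin_poly0 : sqbin_poly 0 = 1.
Proof. by apply/polyP => -[|[|i]]; rewrite coef_sqbin_poly coef1. Qed.

Lemma sqbin_poly1 : sqbin_poly 1 = 1 + 'X.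
Proof. by apply/polyP => -[|[|[|i]]]; rewrite coef_sqbin_poly coefD coef1 coefX. Qed.

(** The generating function of the [sqbin_poly p] is D^(-1/2) with
    D = 1 - 2(1 + X)z + (1 - X)^2 z^2, hence that of their self-convolution is
    1/D: the recurrence now has constant coefficients. *)
Lemma sqbin_conv_rec N :
  sqbin_conv N.+2 =
  ((1 + 'X) * sqbin_conv N.+1) *+ 2 - (1 - 'X) ^+ 2 * sqbin_conv N.
Proof.
apply: (@mulfI _ N.+2%:R); first by rewrite -polyC_natr polyC_eq0 pnatr_eq0.
rewrite -double_weighted_convolution big_ord_recl mul0r add0r big_ord_recl.
rewrite lift0 mul1r sqbin_poly1 subn1 /=.
rewrite (eq_bigr (fun i : 'I_N.+1 => (1 + 'X) *
    ((i.+1%:R * (sqbin_poly i.+1 * sqbin_poly (N.+1 - i.+1)%N)) *+ 2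
     + sqbin_poly i.+1 * sqbin_poly (N.+1 - i.+1)%N) - (1 - 'X) ^+ 2 *
    (i%:R * (sqbin_poly i * sqbin_poly (N - i)%N)
     + sqbin_poly i * sqbin_poly (N - i)%N))); last first.
  move=> i _; rewrite /bump !add1n !subSS mulrA sqbin_poly_rec.
  ring.
rewrite sumrB -!mulr_sumr big_split sumrMnl big_split /=.
have := double_weighted_convolution sqbin_poly N.+1.
rewrite big_ord_recl mul0r add0r /=.
under eq_bigr do rewrite /bump add1n.
move=> ->.
have := double_weighted_convolution sqbin_poly N.
rewrite -/(sqbin_conv N) -/(sqbin_conv N.+1).
have -> : \sum_(i < N.+1) sqbin_poly i.+1 * sqbin_poly (N.+1 - i.+1)%N =
   sqbin_conv N.+1 - sqbin_poly N.+1.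
  rewrite /sqbin_conv [in RHS]big_ord_recl /= sqbin_poly0 subn0 mul1r addrAC subrr add0r.
  by apply: eq_bigr => i _; rewrite /bump add1n.
move: (\sum_(i < N.+1) _%:R * _) => W HW.
transitivity ((1 + 'X) * (N.+2%:R * sqbin_conv N.+1) *+ 2
  - (1 - 'X) ^+ 2 * (W *+ 2 + (sqbin_conv N) *+ 2)); first by ring.
rewrite HW; ring.
Qed.

(** The right-hand side satisfies the same recurrence, by Pascal's rule. *)
Lemma coef_sqbin_conv N j : (sqbin_conv N)`_j *+ 2 = 'C(2 * N + 2, 2 * j + 1)%:R.
Proof.
suff : (sqbin_conv N)`_j *+ 2 = 'C(2 * N + 2, 2 * j + 1)%:R /\
       (sqbin_conv N.+1)`_j *+ 2 = 'C(2 * N.+1 + 2, 2 * j + 1)%:R by case.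
elim: N j => [|N IH] j.
  rewrite /sqbin_conv !big_ord_recl !big_ord0 /= sqbin_poly0 sqbin_poly1.
  rewrite !(mul1r, mulr1, addr0) addrACA !coefD coef1 coefX.
  by split; case: j => [|[|j]] //; rewrite bin_small //; lia.
split; first by case: (IH j).
have e q : (1 - 'X) ^+ 2 * q = q - ('X * q) *+ 2 + 'X * ('X * q) :> {poly int}.
  by ring.
rewrite sqbin_conv_rec e [(1 + _) * _]mulrDl mul1r !(coefB, coefD, coefMn, coefXM).
have -> : (2 * N.+2 + 2 = (2 * N + 2).+4)%N by lia.
have lin (x0 x1 y0 y1 y2 : int) :
    ((x0 + x1) *+ 2 - (y0 - y1 *+ 2 + y2)) *+ 2 =
    (x0 *+ 2 + x1 *+ 2) *+ 2 - (y0 *+ 2 - (y1 *+ 2) *+ 2 + y2 *+ 2) by ring.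
have eS k : (k.+1 == 0%N) = false by [].
rewrite lin; case: j => [|[|j]]; rewrite ?eqxx ?[_.+2.-1]/= ?[_.+1.-1]/= ?eS; cbv match.
- by have [-> ->] := IH 0%N; rewrite !bin1; lia.
- have [-> ->] := IH 0%N; have [-> ->] := IH 1%N.
  have -> : (2 * N.+1 + 2 = (2 * N + 2).+2)%N by lia.
  have -> : (2 * 1 + 1 = 3)%N by [].
  by rewrite !binS !bin0 !bin1; lia.
have [-> _] := IH j; have [-> ->] := IH j.+1; have [-> ->] := IH j.+2.
have -> : (2 * N.+1 + 2 = (2 * N + 2).+2)%N by lia.
have -> : (2 * j.+1 + 1 = (2 * j + 1).+2)%N by lia.
have -> : (2 * j.+2 + 1 = (2 * j + 1).+4)%N by lia.
by rewrite !binS; lia.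
Qed.

(** Grouping the terms by p = j + k, this is the middle coefficient of the
    self-convolution of the polynomials [sqbin_poly]. *)
Lemma sum_sqr_bin_bin (a : nat) :
  (\sum_(j < a.+1) \sum_(k < a.+1)
     ('C(j + k, j) * 'C(2 * a - (j + k), a - j)) ^ 2 = 'C(4 * a + 1, 2 * a))%N.
Proof.
apply/eqP; rewrite -(eqn_pmul2r (isT : 0 < 2)%N); apply/eqP/natr_int_inj.
have -> : ('C(4 * a + 1, 2 * a) * 2 = 'C(2 * (2 * a) + 2, 2 * a + 1))%N.
  have -> : (2 * (2 * a) + 2 = (4 * a + 1).+1)%N by lia.
  have -> : (2 * a + 1 = (2 * a).+1)%N by lia.
  rewrite binS -[in X in _ = (X + _)%N]bin_sub; last by lia.
  have -> : (4 * a + 1 - (2 * a).+1 = 2 * a)%N by lia.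
  by rewrite addnn -muln2.
rewrite -coef_sqbin_conv /sqbin_conv coef_sum natrM mulr_natr natr_sum.
congr (_ *+ 2).
under [RHS]eq_bigr do rewrite coefM.
rewrite exchange_big; apply: eq_bigr => j _ /=.
under [RHS]eq_bigr do rewrite !coef_sqbin_poly.
rewrite natr_sum -(big_mkord xpredT (fun k : nat =>
   (('C(j + k, j) * 'C(2 * a - (j + k), a - j)) ^ 2)%:R : int)).
rewrite -(big_mkord xpredT (fun p : nat =>
   'C(p, j)%:R ^+ 2 * 'C(2 * a - p, a - j)%:R ^+ 2 : int)).
have ja : (j <= a)%N by rewrite -ltnS.
rewrite [RHS](big_cat_nat (n := j)) //=; last by lia.
rewrite [X in _ = X + _]big_nat_cond [X in _ = X + _]big1 ?add0r; last first.
  by move=> i /andP[/andP[_ h] _]; rewrite bin_small // expr0n mul0r.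
rewrite [RHS](big_cat_nat (n := j + a.+1)) /=; [|lia|lia].
rewrite [X in _ = _ + X]big_nat_cond [X in _ = _ + X]big1 ?addr0; last first.
  move=> i /andP[/andP[h h2] _]; rewrite [X in _ * X]expr2.
  by rewrite [in 'C(2 * a - i, _)]bin_small ?mulr0 ?mul0r//; lia.
symmetry; rewrite -{1}[nat_of_ord j]add0n big_addn addKn; apply: eq_bigr => k _.
by rewrite natrX natrM exprMn addnC.
Qed.

(** * Ranks and shuffles of one coordinate *)

Section Rk.
Context (R : realFieldType) (n : nat).
Implicit Types (y z : 'I_n -> R) (S A V : {set 'I_n}) (i j c u v : 'I_n).

Definition rk y S i : nat := #|[pred j in S | y j <= y i]|.

Lemma rk_ltn y S i j : j \in S -> y i < y j -> (rk y S i < rk y S j)%N.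
Proof.
move=> jS ij; apply: proper_card; apply/properP; split.
  apply/subsetP => k; rewrite !inE => /andP[-> ki] /=.
  exact: le_trans ki (ltW ij).
by exists j; rewrite !inE jS ?lexx //= -ltNge.
Qed.

Lemma rk_leq y S i j : j \in S -> (rk y S j <= rk y S i)%N = (y j <= y i).
Proof.
move=> jS; apply/idP/idP => [|ji].
  by case: (leP (y j) (y i)) => // ij; rewrite leqNgt rk_ltn.
apply: subset_leq_card; apply/subsetP => k; rewrite !inE => /andP[-> kj] /=.
exact: le_trans kj ji.
Qed.

Lemma rk_inj y S i j : {in S &, injective y} -> i \in S -> j \in S ->
  rk y S i = rk y S j -> i = j.
Proof.
move=> yI iS jS e; apply: yI => //; apply/le_anti.
by rewrite -!(@rk_leq y S) // e leqnn.
Qed.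

Lemma rk_bounds y S i : i \in S -> (0 < rk y S i <= #|S|)%N.
Proof.
move=> iS; apply/andP; split.
  by apply/card_gt0P; exists i; rewrite !inE iS lexx.
by apply: subset_leq_card; apply/subsetP => k; rewrite !inE => /andP[].
Qed.

Lemma rk_surj y S k : {in S &, injective y} -> (k < #|S|)%N ->
  exists2 i, i \in S & rk y S i = k.+1.
Proof.
move=> yI kS.
pose f (i : 'I_n) : 'I_#|S|.+1 := inord (rk y S i).
have fE i : i \in S -> f i = rk y S i :> nat.
  by move=> iS; rewrite inordK // ltnS; have /andP[] := rk_bounds y iS.
have fI : {in S &, injective f}.
  by move=> i j iS jS /(congr1 val); rewrite /= !fE //; exact: rk_inj.
have : f @: S = [set~ ord0].
  apply/eqP; rewrite eqEcard card_in_imset // cardsC1 card_ord leqnn andbT.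
  apply/subsetP => _ /imsetP[i iS ->]; rewrite !inE -val_eqE /= fE //.
  by rewrite -lt0n; have /andP[] := rk_bounds y iS.
move/setP/(_ (inord k.+1)); rewrite !inE -val_eqE /= inordK ?ltnS//= => /imsetP[i iS].
by move/(congr1 val); rewrite /= fE // inordK ?ltnS// => e; exists i.
Qed.

Lemma sum_rk y S k : {in S &, injective y} -> (k < #|S|)%N ->
  \sum_(i in S) (rk y S i == k.+1)%:R = 1 :> R.
Proof.
move=> yI kS; have [i iS ik] := rk_surj yI kS.
rewrite (bigD1 i) //= ik eqxx big1 ?addr0 // => j /andP[jS ji].
apply/eqP; rewrite pnatr_eq0 eqb0; apply: contra ji => /eqP jk.
by apply/eqP; apply: (rk_inj yI) => //; rewrite ik jk.
Qed.

Lemma rk_perm y S (t : 'S_n) i : (forall j, (t j \in S) = (j \in S)) ->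
  rk (y \o t) S i = rk y S (t i).
Proof.
move=> tS; rewrite /rk -[LHS]cardsE -[RHS]cardsE -[RHS](card_imset _ (@perm_inj _ t^-1%g)).
apply: eq_card => j; rewrite inE; apply/idP/imsetP => [/andP[jS ji]|[k]].
  by exists (t j); rewrite ?permK // !inE /= tS jS.
by rewrite !inE => /andP[kS ki] ->; rewrite /= permKV -tS permKV kS.
Qed.

(** Send each element of [A] to the one which has the same rank in [A] for the
    other sample. *)
Lemma rearrange y y' A : {in A &, injective y} -> {in A &, injective y'} ->
  exists2 rho : 'S_n, perm_on A rho &
    forall i j, i \in A -> j \in A -> (y' (rho i) <= y' (rho j)) = (y i <= y j).
Proof.
move=> yI y'I.
pose f i := if i \in A then odflt i [pick j in A | rk y' A j == rk y A i] else i.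
have fA i : i \in A -> f i \in A /\ rk y' A (f i) = rk y A i.
  move=> iA; rewrite /f iA; case: pickP => [j /andP[jA /eqP]//|no].
  have /andP[r0 rA] := rk_bounds y iA.
  have [|j jA e] := @rk_surj y' A (rk y A i).-1 y'I; first by rewrite prednK.
  by have := no j; rewrite jA e prednK // eqxx.
have fN i : i \notin A -> f i = i by rewrite /f => /negPf ->.
have fI : injective f.
  move=> i j; case: (boolP (i \in A)) => iA; case: (boolP (j \in A)) => jA.
  - have [? ei] := fA i iA; have [? ej] := fA j jA => e.
    by apply: (rk_inj yI) => //; rewrite -ei -ej e.
  - by rewrite (fN j) // => e; have [] := fA i iA; rewrite e (negPf jA).
  - by rewrite (fN i) // => e; have [] := fA j jA; rewrite -e (negPf iA).
  - by rewrite !fN.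
exists (perm fI).
  by apply/subsetP => i; rewrite inE permE; apply: contraR => /fN ->.
move=> i j iA jA; rewrite !permE.
have [? ei] := fA i iA; have [? ej] := fA j jA.
by rewrite -(@rk_leq y' A) // ei ej rk_leq.
Qed.

(** The mean of [f] over all reorderings of [y]: the expectation of [f] for an
    exchangeable sample whose set of values is that of [y]. *)
Definition smean1 y (f : ('I_n -> R) -> R) : R :=
  #|{: 'S_n}|%:R^-1 * \sum_(s : 'S_n) f (y \o s).

Lemma card_perm_neq0 : #|{: 'S_n}|%:R != 0 :> R.
Proof. by rewrite pnatr_eq0 -lt0n; apply/card_gt0P; exists 1%g. Qed.

Lemma smean1_perm (t : 'S_n) y f : smean1 y (fun z => f (z \o t)) = smean1 y f.
Proof.
congr (_ * _); rewrite [RHS](reindex_inj (mulgI t)).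
by apply: eq_bigr => s _; congr f; apply/funext => i /=; rewrite permM.
Qed.

Lemma eq_smean1 y f g : injective y -> (forall z, injective z -> f z = g z) ->
  smean1 y f = smean1 y g.
Proof.
move=> yI fg; congr (_ * _); apply: eq_bigr => s _; apply: fg.
exact: inj_comp yI (@perm_inj _ s).
Qed.

Lemma smean1_cst y (a : R) : smean1 y (fun=> a) = a.
Proof. by rewrite /smean1 sumr_const -[X in _ * X]mulr_natl mulKf // card_perm_neq0. Qed.

Lemma smean1_sum y (I : Type) (r : seq I) (p : pred I) (f : I -> ('I_n -> R) -> R) :
  smean1 y (fun z => \sum_(i <- r | p i) f i z) = \sum_(i <- r | p i) smean1 y (f i).
Proof. by rewrite /smean1 exchange_big mulr_sumr. Qed.

Lemma smean1Z y a f : smean1 y (fun z => a * f z) = a * smean1 y f.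
Proof. by rewrite /smean1 -mulr_sumr mulrCA. Qed.

Lemma smean1_rk y S c k : injective y -> c \in S -> (k < #|S|)%N ->
  smean1 y (fun z => (rk z S c == k.+1)%:R) = #|S|%:R^-1.
Proof.
move=> yI cS kS; have S0 : #|S|%:R != 0 :> R by rewrite pnatr_eq0 -lt0n; case: (#|S|) kS.
have tr i : i \in S -> smean1 y (fun z => (rk z S i == k.+1)%:R) =
                       smean1 y (fun z => (rk z S c == k.+1)%:R).
  move=> iS; rewrite -[RHS](smean1_perm (tperm c i)); apply: eq_smean1 => // z _.
  rewrite rk_perm ?tpermL // => j.
  by case: tpermP => [->|->|//]; rewrite cS iS.
apply: (mulfI S0); rewrite mulfV //.
transitivity (\sum_(i in S) smean1 y (fun z => (rk z S i == k.+1)%:R)).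
  by rewrite (eq_bigr _ tr) sumr_const mulr_natl.
rewrite -smean1_sum -[RHS](smean1_cst y); apply: eq_smean1 => // z zI.
by apply: sum_rk => // ? ? _ _; exact: zI.
Qed.

Definition below c z V : nat := #|[pred j in V | z j < z c]|.

Lemma rk_below z V c : injective z -> c \notin V -> rk z (c |: V) c = (below c z V).+1.
Proof.
move=> zI cV; rewrite /rk /below (cardD1 c) !inE eqxx lexx /= add1n; congr _.+1.
apply: eq_card => j; rewrite !inE; case: eqVneq => [->|jc] /=.
  by rewrite (negPf cV).
by rewrite le_eqVlt (inj_eq zI) (negPf jc).
Qed.

Lemma below_tperm z V c u v : u \in V -> v \notin V -> u != c -> v != c ->
  z v < z c -> ~~ (z u < z c) -> below c (z \o tperm u v) V = (below c z V).+1.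
Proof.
move=> uV vV uc vc vz uz.
rewrite /below (cardD1 u) [in RHS](cardD1 u) !inE uV /= tpermL tpermD // vz (negPf uz).
rewrite add1n add0n; congr _.+1; apply: eq_card => j; rewrite !inE /=.
case: (eqVneq j u) => //= ju; case: (boolP (j \in V)) => //= jV.
by rewrite tpermD // eq_sym //; apply: contraNneq vV => <-.
Qed.

Lemma below_tperm' z V c u v : u \notin V -> v \in V -> u != c -> v != c ->
  z v < z c -> ~~ (z u < z c) -> below c z V = (below c (z \o tperm u v) V).+1.
Proof.
move=> uV vV uc vc vz uz.
have zE : (z \o tperm u v) \o tperm v u = z.
  by apply/funext => j /=; rewrite (tpermC v) tpermK.
have := @below_tperm (z \o tperm u v) V c v u; rewrite zE /= tpermL tpermR tpermD //; exact.
Qed.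

Definition joint_below c A A' y (j j' : nat) : R :=
  smean1 y (fun z => ((below c z A == j) && (below c z A' == j'))%:R).

Lemma card_belowC z V c :
  #|[pred j in V | ~~ (z j < z c)]| = (#|V| - below c z V)%N.
Proof.
rewrite /below -(cardID [pred j | z j < z c] V).
have -> : #|[predI V & [pred j | z j < z c]]| = #|[pred j in V | z j < z c]|.
  by apply: eq_card => j; rewrite !inE.
by rewrite addKn; apply: eq_card => j; rewrite !inE andbC.
Qed.

Lemma card_below_pair z V V' c :
  \sum_(u in V) \sum_(v in V') ((z u < z c) && ~~ (z v < z c))%:R =
  (below c z V)%:R * (#|V'| - below c z V')%:R :> R.
Proof.
rewrite -card_belowC /below -!sum1_card !natr_sum mulr_suml.
rewrite [LHS](bigID (fun u => z u < z c)) /= [X in _ + X]big1 ?addr0; last first.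
  by move=> u /andP[_ /negPf ->]; rewrite big1.
apply: eq_big => [u|u /andP[_ ->]]; first by rewrite !inE.
rewrite mul1r /= [LHS](bigID (fun u => ~~ (z u < z c))) /= [X in _ + X]big1 ?addr0; last first.
  by move=> v /andP[_]; rewrite negbK => ->.
by apply: eq_big => [v|v /andP[_ ->]]; rewrite ?inE.
Qed.

(** Count the pairs (u, v) of [A] x [A'] with u below c and v above, and exchange
    the values at u and v. *)
Lemma joint_below_swap y c A A' (j j' : nat) : injective y -> [disjoint A & A'] ->
  c \notin A -> c \notin A' -> (j < #|A|)%N -> (j' < #|A'|)%N ->
  j.+1%:R * (#|A'| - j')%:R * joint_below c A A' y j.+1 j' =
  (#|A| - j)%:R * j'.+1%:R * joint_below c A A' y j j'.+1.
Proof.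
move=> yI dis cA cA' jA jA'.
transitivity (\sum_(u in A) \sum_(v in A') smean1 y (fun z =>
   ((z u < z c) && ~~ (z v < z c) && ((below c z A == j.+1) && (below c z A' == j')))%:R)).
  under eq_bigr do rewrite -smean1_sum.
  rewrite -smean1_sum -smean1Z; apply: eq_smean1 => // z _.
  case: (eqVneq (below c z A) j.+1) => [e|_]; last first.
    by rewrite /= ?andbF mulr0 big1 // => u _; rewrite big1 // => v _; rewrite ?andbF.
  case: (eqVneq (below c z A') j') => [e'|_]; last first.
    by rewrite /= ?andbF mulr0 big1 // => u _; rewrite big1 // => v _; rewrite ?andbF.
  rewrite mulr1 -e -e' -card_below_pair; apply: eq_bigr => u _.
  by apply: eq_bigr => v _; rewrite !andbT.
transitivity (\sum_(u in A) \sum_(v in A') smean1 y (fun z =>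
   ((z v < z c) && ~~ (z u < z c) && ((below c z A == j) && (below c z A' == j'.+1)))%:R)).
  apply: eq_bigr => u uA; apply: eq_bigr => v vA'.
  have vA : v \notin A by apply: contraL vA' => vA; rewrite (disjointFr dis vA).
  have uA' : u \notin A' by rewrite (disjointFr dis uA).
  have uc : u != c by apply: contraNneq cA => <-.
  have vc : v != c by apply: contraNneq cA' => <-.
  rewrite -(smean1_perm (tperm u v)); apply: eq_smean1 => // z _ /=.
  rewrite tpermL tpermR tpermD //.
  case: (boolP (z v < z c)) => //= vz; case: (boolP (z u < z c)) => //= uz.
  by rewrite below_tperm // (@below_tperm' z A' c u v) // !eqSS.
rewrite exchange_big /=.
under eq_bigr do rewrite -smean1_sum.
rewrite -smean1_sum -smean1Z; apply: eq_smean1 => // z _.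
case: (eqVneq (below c z A) j) => [e|_]; last first.
  by rewrite /= ?andbF mulr0 big1 // => u _; rewrite big1 // => v _; rewrite ?andbF.
case: (eqVneq (below c z A') j'.+1) => [e'|_]; last first.
  by rewrite /= ?andbF mulr0 big1 // => u _; rewrite big1 // => v _; rewrite ?andbF.
rewrite mulr1 -e -e' mulrC -card_below_pair; apply: eq_bigr => u _.
by apply: eq_bigr => v _; rewrite !andbT.
Qed.

Lemma below_leq c z V : (below c z V <= #|V|)%N.
Proof. by apply: subset_leq_card; apply/subsetP => k; rewrite !inE => /andP[]. Qed.

Lemma belowU c z V V' : [disjoint V & V'] ->
  below c z (V :|: V') = (below c z V + below c z V')%N.
Proof.
move=> dis; rewrite /below -cardUI [X in (_ + X)%N]eq_card0 ?addn0; last first.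
  move=> j; rewrite !inE; apply/negP => /andP[/andP[jV _] /andP[jV' _]].
  by rewrite (disjointFr dis jV) in jV'.
by apply: eq_card => j; rewrite !inE andb_orl.
Qed.

Lemma joint_below_eq0 c A A' y (j j' : nat) : (#|A| < j)%N || (#|A'| < j')%N ->
  joint_below c A A' y j j' = 0.
Proof.
move=> h; rewrite -[RHS](smean1_cst y); congr (_ * _); apply: eq_bigr => s _.
apply/eqP; rewrite pnatr_eq0 eqb0 negb_and; case/orP: h => h; apply/orP; [left|right].
  by rewrite neq_ltn (leq_ltn_trans (below_leq _ _ _) h).
by rewrite neq_ltn (leq_ltn_trans (below_leq _ _ _) h).
Qed.

(** Exchanging values moves one unit between the two counts; by
    [joint_below_swap], the joint law divided by the product of binomials only
    depends on the sum of the counts. *)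
Lemma joint_below_ratio y c A A' a : injective y -> [disjoint A & A'] ->
  c \notin A -> c \notin A' -> #|A| = a -> #|A'| = a ->
  forall t j j' : nat, (j + t <= a)%N -> (j' + t <= a)%N ->
  joint_below c A A' y (j + t) j' / ('C(a, j + t) * 'C(a, j'))%:R =
  joint_below c A A' y j (j' + t) / ('C(a, j) * 'C(a, j' + t))%:R.
Proof.
move=> yI dis cA cA' Aa Aa'; elim=> [|t IH] j j' jt jt'; first by rewrite !addn0.
have -> : (j + t.+1 = j.+1 + t)%N by lia.
rewrite IH; [|lia|lia].
have -> : (j' + t.+1 = (j' + t).+1)%N by lia.
have ja : (j < a)%N by lia.
have ja' : (j' + t < a)%N by lia.
have := @joint_below_swap y c A A' j (j' + t) yI dis cA cA'.
rewrite Aa Aa' => /(_ ja ja') e.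
have C0 k : (k <= a)%N -> 'C(a, k)%:R != 0 :> R.
  by move=> ?; rewrite pnatr_eq0 -lt0n bin_gt0.
have e1 : j.+1%:R * 'C(a, j.+1)%:R = (a - j)%:R * 'C(a, j)%:R :> R.
  by rewrite -!natrM mul_bin_left.
have e2 : (j' + t).+1%:R * 'C(a, (j' + t).+1)%:R =
          (a - (j' + t))%:R * 'C(a, j' + t)%:R :> R.
  by rewrite -!natrM mul_bin_left.
apply/eqP; rewrite eqr_div ?natrM ?mulf_neq0 ?C0 //; [|lia..].
apply/eqP.
have n1 : j.+1%:R != 0 :> R by rewrite pnatr_eq0.
have n2 : (a - (j' + t))%:R != 0 :> R by rewrite pnatr_eq0 -lt0n subn_gt0.
apply: (mulfI (mulf_neq0 n1 n2)); rewrite mulrA e.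
transitivity ((a - j)%:R * 'C(a, j)%:R * ((j' + t).+1%:R * 'C(a, (j' + t).+1)%:R)
  * joint_below c A A' y j (j' + t).+1); first by ring.
by rewrite -e1 e2; ring.
Qed.

(** The number of elements of [A] and [A'] below c is uniform on {0, ..., 2a},
    since it is a rank; [joint_below_ratio] and Vandermonde's identity
    distribute this mass over the pairs of counts of given sum. *)
Lemma joint_belowE y c A A' a (j j' : nat) : injective y -> [disjoint A & A'] ->
  c \notin A -> c \notin A' -> #|A| = a -> #|A'| = a -> (j <= a)%N -> (j' <= a)%N ->
  joint_below c A A' y j j' =
  ('C(a, j) * 'C(a, j'))%:R / ((2 * a).+1 * 'C(2 * a, j + j'))%:R.
Proof.
move=> yI dis cA cA' Aa Aa' ja ja'.
have [s sE] : exists s, s = (j + j')%N by eexists.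
rewrite -sE.
have CA0 : ('C(a, j) * 'C(a, j'))%:R != 0 :> R.
  by rewrite pnatr_eq0 -lt0n muln_gt0 !bin_gt0 ja.
have key (i : 'I_s.+1) : joint_below c A A' y i (s - i) =
   ('C(a, i) * 'C(a, s - i))%:R *
   (joint_below c A A' y j j' / ('C(a, j) * 'C(a, j'))%:R).
  have i_s : (i <= s)%N by rewrite -ltnS.
  case: (boolP ((i <= a)%N && (s - i <= a)%N)) => [/andP[ia sia]|h]; last first.
    rewrite joint_below_eq0 ?Aa ?Aa'; last by move: h; rewrite negb_and -!ltnNge.
    move: h; rewrite negb_and -!ltnNge => /orP[h|h].
      by rewrite bin_small // mul0r.
    by rewrite [X in (_ * X)%N]bin_small // muln0 mul0r.
  have CI0 : ('C(a, i) * 'C(a, s - i))%:R != 0 :> R.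
    by rewrite pnatr_eq0 -lt0n muln_gt0 !bin_gt0 ia.
  apply: (mulIf (invr_neq0 CI0)); rewrite [RHS]mulrAC mulfV // mul1r.
  case: (leqP i j) => [ij|ji].
    have := @joint_below_ratio y c A A' a yI dis cA cA' Aa Aa' (j - i) i j'.
    have -> : (i + (j - i) = j)%N by lia.
    have -> : (j' + (j - i) = s - i)%N by lia.
    by move=> -> //; lia.
  have := @joint_below_ratio y c A A' a yI dis cA cA' Aa Aa' (i - j) j (s - i).
  have -> : (j + (i - j) = i)%N by lia.
  have -> : (s - i + (i - j) = j')%N by lia.
  by move=> ->.
have cAA' : c \notin A :|: A' by rewrite inE negb_or cA.
have cardU : #|A :|: A'| = (2 * a)%N.
  by rewrite cardsU (disjoint_setI0 dis) cards0 subn0 Aa Aa' addnn mul2n.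
have sU : (s < #|c |: (A :|: A')|)%N by rewrite cardsU1 cAA' cardU; lia.
have : \sum_(i < s.+1) joint_below c A A' y i (s - i) = (2 * a).+1%:R^-1.
  transitivity (#|c |: (A :|: A')|%:R^-1 : R); last by rewrite cardsU1 cAA' cardU.
  rewrite -(@smean1_rk y _ c s) ?setU11 // -smean1_sum; apply: eq_smean1 => // z zI.
  rewrite rk_below // belowU // eqSS.
  case: (eqVneq (below c z A + below c z A')%N s) => [e|ne]; last first.
    rewrite big1 // => i _; apply/eqP; rewrite pnatr_eq0 eqb0.
    apply: contra ne => /andP[/eqP -> /eqP ->]; rewrite subnKC //.
    by rewrite -ltnS.
  have bs : (below c z A < s.+1)%N by rewrite ltnS -e leq_addr.
  have e' : (s - below c z A = below c z A')%N by rewrite -e addKn.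
  rewrite (bigD1 (Ordinal bs)) //= e' !eqxx big1 ?addr0 // => i.
  by rewrite -val_eqE /= eq_sym => /negPf ->.
under eq_bigr do rewrite key.
rewrite -mulr_suml -natr_sum.
have -> : (\sum_(i < s.+1) 'C(a, i) * 'C(a, s - i) = 'C(2 * a, s))%N.
  by rewrite binomial.Vandermonde mul2n addnn.
have Cs0 : 'C(2 * a, s)%:R != 0 :> R by rewrite pnatr_eq0 -lt0n bin_gt0; lia.
move=> e; rewrite [((2 * a).+1 * _)%:R]natrM invfM -e.
move: Cs0 CA0; move: ('C(2 * a, s))%:R ('C(a, j) * 'C(a, j'))%:R => u v u0 v0.
by field; rewrite u0 v0.
Qed.

End Rk.

(** * Joint ranks in two subsets sharing one observation *)

Section JointRank.
Context (R : realFieldType).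

(** The joint law of the two ranks (counted from 0) of the common observation
    of two sets of size a + 1.  It is the integral over [0,1] of the product of
    the Bernstein polynomials of degree a and indices k and k'. *)
Definition rank_joint (a k k' : nat) : R :=
  ('C(a, k) * 'C(a, k'))%:R / ((2 * a).+1 * 'C(2 * a, k + k'))%:R.

Lemma rank_jointC a k k' : rank_joint a k k' = rank_joint a k' k.
Proof. by rewrite /rank_joint mulnC addnC. Qed.

Definition joint_rank n (y : 'I_n -> R) (S S' : {set 'I_n}) i j (k k' : nat) : R :=
  smean1 y (fun z => (rk z S i == k.+1)%:R * (rk z S' j == k'.+1)%:R).

Lemma joint_rankC n (y : 'I_n -> R) S S' i j k k' :
  joint_rank y S S' i j k k' = joint_rank y S' S j i k' k.
Proof. by congr (_ * _); apply: eq_bigr => s _; rewrite mulrC. Qed.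

Context (n a : nat) (y : 'I_n -> R) (yI : injective y).
Implicit Types (S : {set 'I_n}) (c i j : 'I_n).

Lemma joint_rank_common S S' c k k' : #|S| = a.+1 -> #|S'| = a.+1 ->
  S :&: S' = [set c] -> (k <= a)%N -> (k' <= a)%N ->
  joint_rank y S S' c c k k' = rank_joint a k k'.
Proof.
move=> Sa S'a SS' ka k'a.
have /setIP[cS cS'] : c \in S :&: S' by rewrite SS' set11.
have dis : [disjoint S :\ c & S' :\ c].
  rewrite -setI_eq0; apply/eqP/setP => u; have /setP/(_ u) := SS'.
  by rewrite !inE; case: (u == c).
rewrite /rank_joint -(@joint_belowE _ _ y c (S :\ c) (S' :\ c)) ?setD11 //; last 2 first.
- by have := cardsD1 c S; rewrite cS Sa => -[].
- by have := cardsD1 c S'; rewrite cS' S'a => -[].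
apply: eq_smean1 => // z zI; rewrite -{1}(setD1K cS) -{1}(setD1K cS').
by rewrite !rk_below ?setD11 // !eqSS -natrM mulnb.
Qed.

(** Some element of [S] has rank [k] in [S].  It is c, or one of the a other
    ones, which play the same role because they are not in [S']. *)
Lemma joint_rank_sum S S' c i j k k' : #|S| = a.+1 -> #|S'| = a.+1 ->
  S :&: S' = [set c] -> i \in S -> i != c -> j \in S' ->
  (k <= a)%N -> (k' <= a)%N ->
  joint_rank y S S' c j k k' + a%:R * joint_rank y S S' i j k k' = a.+1%:R^-1.
Proof.
move=> Sa S'a SS' iS ic jS' ka k'a.
have /setIP[cS cS'] : c \in S :&: S' by rewrite SS' set11.
have notS' u : u \in S -> u != c -> u \notin S'.
  by move=> uS; apply: contra => uS'; rewrite -in_set1 -SS' inE uS uS'.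
have tr u : u \in S :\ c -> joint_rank y S S' u j k k' = joint_rank y S S' i j k k'.
  move=> /setD1P[uc uS]; rewrite -[RHS](smean1_perm (tperm i u)).
  apply: eq_smean1 => // z _; rewrite !rk_perm ?tpermL; first last.
  - by move=> v; case: tpermP => [->|->|//]; rewrite iS uS.
  - move=> v; case: tpermP => [->|->|//].
      by rewrite (negPf (notS' _ iS ic)) (negPf (notS' _ uS uc)).
    by rewrite (negPf (notS' _ iS ic)) (negPf (notS' _ uS uc)).
  rewrite tpermD //; first by apply: contraNneq (notS' _ iS ic) => ->.
  by apply: contraNneq (notS' _ uS uc) => ->.
have -> : a = #|S :\ c| by have := cardsD1 c S; rewrite cS Sa => -[].
rewrite mulr_natl -sumr_const -(eq_bigr _ tr) -(big_setD1 c cS) /=.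
rewrite -smean1_sum.
have -> : #|S :\ c|.+1 = #|S'| by rewrite S'a -Sa (cardsD1 c S) cS.
rewrite -(@smean1_rk _ _ y S' j k') ?S'a //; apply: eq_smean1 => // z zI.
rewrite -mulr_suml sum_rk ?mul1r ?Sa //.
by move=> ? ? _ _; exact: zI.
Qed.

(** The joint laws of two ranks when one, respectively both, of the
    observations differ from the common one. *)
Definition rank_mixed (k k' : nat) : R := (a.+1%:R^-1 - rank_joint a k k') / a%:R.
Definition rank_apart (k k' : nat) : R :=
  (1 - 2 / a.+1%:R + rank_joint a k k') / a%:R ^+ 2.

Context (a_gt0 : (0 < a)%N).
Let a0 : a%:R != 0 :> R. Proof. by rewrite pnatr_eq0 -lt0n. Qed.

Lemma joint_rank_mixed S S' c i k k' : #|S| = a.+1 -> #|S'| = a.+1 ->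
  S :&: S' = [set c] -> i \in S -> i != c -> (k <= a)%N -> (k' <= a)%N ->
  joint_rank y S S' i c k k' = rank_mixed k k'.
Proof.
move=> Sa S'a SS' iS ic ka k'a.
have /setIP[cS cS'] : c \in S :&: S' by rewrite SS' set11.
rewrite /rank_mixed -(@joint_rank_common S S' c) //.
by rewrite -(@joint_rank_sum S S' c i c k k') // addrAC subrr add0r mulrAC mulfV // mul1r.
Qed.

Lemma joint_rank_apart S S' c i j k k' : #|S| = a.+1 -> #|S'| = a.+1 ->
  S :&: S' = [set c] -> i \in S -> i != c -> j \in S' -> j != c ->
  (k <= a)%N -> (k' <= a)%N ->
  joint_rank y S S' i j k k' = rank_apart k k'.
Proof.
move=> Sa S'a SS' iS ic jS' jc ka k'a.
have /setIP[cS cS'] : c \in S :&: S' by rewrite SS' set11.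
have := @joint_rank_sum S' S c j i k' k S'a Sa.
rewrite setIC => /(_ SS' jS' jc iS k'a ka).
rewrite -!(joint_rankC y S S') (@joint_rank_mixed S S' c) // => e.
apply: (mulfI a0); apply/eqP; rewrite -(inj_eq (addrI (rank_mixed k k'))) e.
rewrite /rank_mixed /rank_apart.
apply/eqP; have a1 : a.+1%:R != 0 :> R by rewrite pnatr_eq0.
rewrite -natr1 in a1 *; field; rewrite a0 //.
Qed.

End JointRank.

(** The marginal laws of [rank_joint] are uniform.  This is read off two
    explicit sets of size a + 1 sharing one element. *)
Lemma sum_rank_joint (R : realFieldType) a k : (k <= a)%N ->
  \sum_(k' < a.+1) rank_joint R a k k' = a.+1%:R^-1.
Proof.
move=> ka.
pose c := @rshift a a.+1 ord0.
pose A := [set lshift a.+1 i | i : 'I_a].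
pose A' := [set rshift a (lift ord0 i) | i : 'I_a].
pose y (i : 'I_(a + a.+1)) : R := (val i)%:R.
have yI : injective y by move=> i j /eqP; rewrite eqr_nat => /eqP /val_inj.
have Aa : #|A| = a by rewrite card_imset ?card_ord //; exact: lshift_inj.
have A'a : #|A'| = a.
  by rewrite card_imset ?card_ord // => i j /rshift_inj/lift_inj.
have cA : c \notin A by apply/imsetP => -[i _ /eqP]; rewrite eq_rlshift.
have cA' : c \notin A'.
  by apply/imsetP => -[i _ /rshift_inj /eqP]; rewrite (negPf (neq_lift _ _)).
have dis : [disjoint A & A'].
  rewrite -setI_eq0; apply/eqP/setP => i; rewrite !inE; apply/negP.
  by move=> /andP[/imsetP[u _ ->] /imsetP[v _ /eqP]]; rewrite eq_lrshift.
have cU : #|c |: A| = a.+1 by rewrite cardsU1 cA Aa.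
rewrite -cU -(@smean1_rk _ _ y (c |: A) c k) ?setU11 ?cU //.
under eq_bigr => k' _ do rewrite /rank_joint -(joint_belowE yI dis cA cA' Aa A'a ka) -1?ltnS //.
rewrite -smean1_sum; apply: eq_smean1 => // z zI.
rewrite rk_below // eqSS.
have bA : (below c z A' < a.+1)%N by rewrite ltnS -[X in (_ <= X)%N]A'a below_leq.
rewrite (bigD1 (Ordinal bA)) //= eqxx andbT big1 ?addr0 // => i.
by rewrite -val_eqE /= eq_sym => /negPf ->; rewrite andbF.
Qed.

(** * Shuffles of the coordinates of a sample *)

Section Samples.
Context (R : realType) (d n : nat).
Implicit Types (x : 'I_n -> d.-tuple R) (A S : {set 'I_n}).
Implicit Types (F G : ('I_n -> d.-tuple R) -> R) (p : {ffun 'I_d -> 'S_n}).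

Definition coordinate x (l : 'I_d) : 'I_n -> R := fun i => tnth (x i) l.

Definition no_ties x := forall l, injective (coordinate x l).

Definition permute x p : 'I_n -> d.-tuple R :=
  fun i => [tuple tnth (x (p l i)) l | l < d].

Lemma tnth_permute x p i l : tnth (permute x p i) l = tnth (x (p l i)) l.
Proof. by rewrite tnth_mktuple. Qed.

Lemma coordinate_permute x p l : coordinate (permute x p) l = coordinate x l \o p l.
Proof. by apply/funext => i; rewrite /coordinate tnth_permute. Qed.

Lemma no_ties_permute x p : no_ties x -> no_ties (permute x p).
Proof. by move=> xI l; rewrite coordinate_permute; apply: inj_comp (xI l) (@perm_inj _ _). Qed.

Definition comp_perms p p' : {ffun 'I_d -> 'S_n} := [ffun l => (p l * p' l)%g].

Lemma permute_comp_perms x p p' : permute x (comp_perms p p') = permute (permute x p') p.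
Proof.
apply/funext => i; apply/eq_from_tnth => l.
by rewrite !tnth_permute /comp_perms ffunE permM.
Qed.

Lemma comp_perms_bijr p' : bijective (comp_perms^~ p').
Proof.
exists (fun p => [ffun l => (p l * (p' l)^-1)%g]) => p; apply/ffunP => l.
  by rewrite !ffunE mulgK.
by rewrite !ffunE mulgKV.
Qed.

Lemma comp_perms_bijl p' : bijective (comp_perms p').
Proof.
exists (fun p => [ffun l => ((p' l)^-1 * p l)%g]) => p; apply/ffunP => l.
  by rewrite !ffunE mulKg.
by rewrite !ffunE mulKVg.
Qed.

(** The expectation of [F] when each coordinate is shuffled by an independent
    uniform permutation. *)
Definition smean x F : R :=
  #|{: {ffun 'I_d -> 'S_n}}|%:R^-1 * \sum_p F (permute x p).

Lemma card_permute_neq0 : #|{: {ffun 'I_d -> 'S_n}}|%:R != 0 :> R.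
Proof. by rewrite pnatr_eq0 -lt0n; apply/card_gt0P; exists [ffun=> 1%g]. Qed.

Lemma eq_smean x F G : no_ties x -> (forall z, no_ties z -> F z = G z) ->
  smean x F = smean x G.
Proof.
by move=> xI FG; congr (_ * _); apply: eq_bigr => p _; apply/FG/no_ties_permute.
Qed.

Lemma smean_cst x (c : R) : smean x (fun=> c) = c.
Proof. by rewrite /smean sumr_const -[X in _ * X]mulr_natl mulKf // card_permute_neq0. Qed.

Lemma smean_sum x (I : Type) (r : seq I) (P : pred I) (F : I -> ('I_n -> d.-tuple R) -> R) :
  smean x (fun z => \sum_(i <- r | P i) F i z) = \sum_(i <- r | P i) smean x (F i).
Proof. by rewrite /smean exchange_big mulr_sumr. Qed.

Lemma smeanZ x c F : smean x (fun z => c * F z) = c * smean x F.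
Proof. by rewrite /smean -mulr_sumr mulrCA. Qed.

Lemma smeanD x F G : smean x (fun z => F z + G z) = smean x F + smean x G.
Proof. by rewrite /smean big_split mulrDr. Qed.

Lemma smean_norm_le x F c : no_ties x ->
  (forall z, no_ties z -> `|F z| <= c) -> `|smean x F| <= c.
Proof.
move=> xI Fc; rewrite -[leRHS](smean_cst x) /smean normrM ger0_norm ?invr_ge0 ?ler0n //.
rewrite ler_wpM2l ?invr_ge0 ?ler0n // (le_trans (ler_norm_sum _ _ _)) //.
by apply: ler_sum => p _; apply/Fc/no_ties_permute.
Qed.

Lemma smean_permute x F p : smean x (fun z => F (permute z p)) = smean x F.
Proof.
congr (_ * _); rewrite [RHS](reindex (comp_perms p)); last exact/onW_bij/comp_perms_bijl.
by apply: eq_bigr => p' _; rewrite permute_comp_perms.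
Qed.

Lemma smean_prod x (f : 'I_d -> ('I_n -> R) -> R) :
  smean x (fun z => \prod_l f l (coordinate z l)) = \prod_l smean1 (coordinate x l) (f l).
Proof.
rewrite /smean /smean1 big_split /= prodr_const card_ord card_ffun card_ord natrX exprVn.
congr (_ * _); rewrite bigA_distr_bigA; apply: eq_bigr => p _.
by apply: eq_bigr => l _; rewrite coordinate_permute.
Qed.

(** [F] only depends on the order of the observations of [A], coordinate by
    coordinate. *)
Definition local A F := forall x x',
  (forall l i j, i \in A -> j \in A ->
     (tnth (x i) l <= tnth (x j) l) = (tnth (x' i) l <= tnth (x' j) l)) ->
  F x = F x'.

Lemma localS A A' F : A \subset A' -> local A F -> local A' F.
Proof.
move=> /subsetP AA' lF x x' xx'; apply: lF => l i j iA jA.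
by apply: xx'; apply: AA'.
Qed.

Lemma localM A F G : local A F -> local A G -> local A (fun z => F z * G z).
Proof. by move=> lF lG x x' xx'; rewrite (lF x x') // (lG x x'). Qed.

Definition moves_only A : pred {ffun 'I_d -> 'S_n} := fun p => [forall l, perm_on A (p l)].

Definition sum_shuffles A x F : R := \sum_(p | moves_only A p) F (permute x p).

(** The orders on [A] reached from [x] by permuting the elements of [A] are all
    orders, each exactly once. *)
Lemma sum_shuffles_const A F x x' : local A F -> no_ties x -> no_ties x' ->
  sum_shuffles A x F = sum_shuffles A x' F.
Proof.
move=> lF xI x'I.
have xIn y l : no_ties y -> {in A &, injective (coordinate y l)}.
  by move=> yI i j _ _; apply: yI.
have [r rP] : exists r : {ffun 'I_d -> 'S_n}, forall l, perm_on A (r l) /\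
   forall i j, i \in A -> j \in A ->
   (coordinate x' l (r l i) <= coordinate x' l (r l j)) =
   (coordinate x l i <= coordinate x l j).
  have h l : exists s : 'S_n, perm_on A s /\ forall i j, i \in A -> j \in A ->
     (coordinate x' l (s i) <= coordinate x' l (s j)) =
     (coordinate x l i <= coordinate x l j).
    by have [s ? ?] := rearrange (xIn _ l xI) (xIn _ l x'I); exists s.
  exists [ffun l => projT1 (cid (h l))] => l; rewrite ffunE.
  exact: projT2 (cid (h l)).
rewrite /sum_shuffles [RHS](reindex (comp_perms^~ r)); last exact/onW_bij/comp_perms_bijr.
apply: eq_big => [p|p /forallP pA].
  apply: eq_forallb => l; rewrite ffunE; have [rA _] := rP l.
  apply/idP/idP => [pA|]; first exact: perm_onM.
  move=> h; rewrite -(mulgK (r l) (p l)); apply: perm_onM => //.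
  exact: perm_onV.
apply: lF => l i j iA jA; rewrite !tnth_permute !ffunE !permM.
have [_ rE] := rP l; rewrite -[LHS]rE //; rewrite perm_closed //.
Qed.

Lemma smean_const F x x' : local setT F -> no_ties x -> no_ties x' -> smean x F = smean x' F.
Proof.
move=> lF xI x'I; congr (_ * _).
have := sum_shuffles_const lF xI x'I; rewrite /sum_shuffles => h.
have aT p : moves_only setT p by apply/forallP => l; apply/subsetP => i _; rewrite inE.
transitivity (\sum_(p | moves_only setT p) F (permute x p)).
  by apply: eq_bigl => p; rewrite aT.
by rewrite h; apply: eq_bigl => p; rewrite aT.
Qed.

(** A shuffle may be followed by a permutation moving only elements of [A].
    Averaging over the latter does not affect [G], and replaces [F] by a
    constant. *)
Lemma smean_indep A A' F G x : [disjoint A & A'] -> local A F -> local A' G ->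
  no_ties x -> smean x (fun z => F z * G z) = smean x F * smean x G.
Proof.
move=> dis lF lG xI.
have fixA' p l i : moves_only A p -> i \in A' -> p l i = i.
  move=> /forallP/(_ l) pA iA'; apply: out_perm pA _.
  by apply: contraL iA' => iA; rewrite (disjointFr dis iA).
have key H : local A' H ->
   #|moves_only A|%:R * smean x (fun z => F z * H z) = sum_shuffles A x F * smean x H.
  move=> lH; rewrite mulr_natl -sumr_const -smeanZ.
  transitivity (smean x (fun z => \sum_(p | moves_only A p) F (permute z p) * H z)).
    rewrite smean_sum; apply: eq_bigr => p pA; rewrite -(smean_permute _ _ p).
    apply: eq_smean => // z _; congr (_ * _).
    by apply: lH => l i j iA jA; rewrite !tnth_permute !(fixA' p l).
  by apply: eq_smean => // z zI; rewrite -mulr_suml -(sum_shuffles_const lF zI xI).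
have N0 : #|moves_only A|%:R != 0 :> R.
  rewrite pnatr_eq0 -lt0n; apply/card_gt0P; exists [ffun=> 1%g].
  by apply/forallP => l; rewrite ffunE perm_on1.
have := key (fun=> 1) (fun _ _ _ => erefl); rewrite smean_cst mulr1.
rewrite (_ : (fun z => F z * 1) = F) => [e|]; last by apply/funext => z; rewrite mulr1.
by apply: (mulfI N0); rewrite key // [RHS]mulrA e.
Qed.

End Samples.

(** * Occupied cells *)

Lemma local_B (R : realType) (d m n : nat) (S : {set 'I_n}) (r : {ffun 'I_d -> 'I_m}) :
  local S (fun z : 'I_n -> d.-tuple R => B z S r).
Proof.
move=> x x' xx'; rewrite /B; congr ((_ : bool)%:R).
apply: eq_existsb => i; case: (boolP (i \in S)) => //= iS.
apply: eq_forallb => l; congr (_ == _); apply: eq_card => j; rewrite !inE.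
by case: (boolP (j \in S)) => //= jS; rewrite xx'.
Qed.

Section Cells.
Context (R : realType) (d n a : nat).
Context (d_gt0 : (0 < d)%N) (a_gt0 : (0 < a)%N).
Implicit Types (x z : 'I_n -> d.-tuple R) (S : {set 'I_n}) (r : {ffun 'I_d -> 'I_a.+1}).

(** At most one observation has the given rank vector: this needs a coordinate,
    whence the hypothesis on d. *)
Lemma B_sum z S r : no_ties z ->
  B z S r = \sum_(i in S) \prod_l (rk (coordinate z l) S i == (r l).+1)%:R.
Proof.
move=> zI; rewrite /B.
have prodE i : \prod_l (rk (coordinate z l) S i == (r l).+1)%:R =
               [forall l, rank z S i l == (r l).+1]%:R :> R.
  case: forallP => [h|/forallP]; first by rewrite big1 // => l _; rewrite (h l).
  by rewrite negb_forall => /existsP[l /negPf h]; rewrite (bigD1 l) //= [rk _ _ _ == _]h mul0r.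
under eq_bigr do rewrite prodE.
case: existsP => [[i /andP[iS /forallP iP]]|no]; last first.
  rewrite big1 // => i iS; apply/eqP; rewrite pnatr_eq0 eqb0; apply/negP => h.
  by apply: no; exists i; rewrite iS.
rewrite (bigD1 i) //= (introT forallP iP) big1 ?addr0 // => j /andP[jS ji].
apply/eqP; rewrite pnatr_eq0 eqb0; apply: contra ji => /forallP jP.
pose l := Ordinal d_gt0; apply/eqP.
apply: (@rk_inj _ _ (coordinate z l) S) => //; first by move=> ? ? _ _; exact: zI.
exact: etrans (eqP (jP l)) (esym (eqP (iP l))).
Qed.

Definition cell_prob : R := a.+1%:R / a.+1%:R ^+ d.

Lemma smean_B x S r : no_ties x -> #|S| = a.+1 -> smean x (fun z => B z S r) = cell_prob.
Proof.
move=> xI Sa; rewrite (eq_smean xI (fun z zI => B_sum S r zI)) smean_sum.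
transitivity (\sum_(i in S) a.+1%:R ^- d : R); last first.
  by rewrite sumr_const Sa /cell_prob mulr_natl.
apply: eq_bigr => i iS.
rewrite (smean_prod x (fun l y => (rk y S i == (r l).+1)%:R)).
rewrite -exprVn -[X in _ ^+ X]card_ord -prodr_const; apply: eq_bigr => l _.
by rewrite smean1_rk // Sa.
Qed.

Definition qprod (q : nat -> nat -> R) r r' : R := \prod_l q (r l) (r' l).

(** The covariance of the occupation of the cell [r] in a set and of the cell
    [r'] in another set sharing one observation with it.  The three products
    correspond to both cells being occupied by the common observation, exactly
    one of them, or none. *)
Definition cell_cov r r' : R :=
  qprod (rank_joint R a) r r' + 2 * a%:R * qprod (rank_mixed R a) r r' +
  a%:R ^+ 2 * qprod (rank_apart R a) r r' - cell_prob ^+ 2.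

Lemma smean_BB x S S' c r r' : no_ties x -> #|S| = a.+1 -> #|S'| = a.+1 ->
  S :&: S' = [set c] ->
  smean x (fun z => B z S r * B z S' r') = cell_cov r r' + cell_prob ^+ 2.
Proof.
move=> xI Sa S'a SS'; rewrite /cell_cov subrK.
have /setIP[cS cS'] : c \in S :&: S' by rewrite SS' set11.
have BE z : no_ties z -> B z S r * B z S' r' = \sum_(i in S) \sum_(j in S')
    \prod_l ((rk (coordinate z l) S i == (r l).+1)%:R *
             (rk (coordinate z l) S' j == (r' l).+1)%:R).
  move=> zI; rewrite !B_sum // mulr_suml; apply: eq_bigr => i _.
  by rewrite mulr_sumr; apply: eq_bigr => j _; rewrite big_split.
rewrite (eq_smean xI BE) smean_sum.
have ExE i : smean x (fun z => \sum_(j in S')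
    \prod_l ((rk (coordinate z l) S i == (r l).+1)%:R *
             (rk (coordinate z l) S' j == (r' l).+1)%:R))
  = \sum_(j in S') \prod_l joint_rank (coordinate x l) S S' i j (r l) (r' l).
  rewrite smean_sum; apply: eq_bigr => j _.
  exact: (smean_prod x (fun l y =>
    (rk y S i == (r l).+1)%:R * (rk y S' j == (r' l).+1)%:R)).
under eq_bigr do rewrite ExE.
have rl (r0 : {ffun 'I_d -> 'I_a.+1}) l : (r0 l <= a)%N by rewrite -ltnS.
have Sc : #|S :\ c| = a by have := cardsD1 c S; rewrite cS Sa => -[].
have S'c : #|S' :\ c| = a by have := cardsD1 c S'; rewrite cS' S'a => -[].
rewrite (big_setD1 c cS) /= (big_setD1 c cS') /=.
rewrite (_ : \prod_l _ = qprod (rank_joint R a) r r'); last first.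
  by apply: eq_bigr => l _; rewrite (joint_rank_common (xI l) Sa S'a SS').
rewrite (_ : \sum_(j in S' :\ c) _ = a%:R * qprod (rank_mixed R a) r r'); last first.
  rewrite mulr_natl -[X in _ *+ X]S'c -sumr_const; apply: eq_bigr => j /setD1P[jc jS'].
  apply: eq_bigr => l _; rewrite joint_rankC.
  rewrite (@joint_rank_mixed _ _ a _ (xI l) a_gt0 S' S c) // 1?setIC //.
  by rewrite /rank_mixed rank_jointC.
rewrite (_ : \sum_(i in S :\ c) _ =
   a%:R * (qprod (rank_mixed R a) r r' + a%:R * qprod (rank_apart R a) r r')); last first.
  rewrite mulr_natl -[X in _ *+ X]Sc -sumr_const; apply: eq_bigr => i /setD1P[ic iS].
  rewrite (big_setD1 c cS') /=; congr (_ + _).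
    apply: eq_bigr => l _.
    by rewrite (@joint_rank_mixed _ _ a _ (xI l) a_gt0 S S' c).
  rewrite mulr_natl -[X in _ *+ X]S'c -sumr_const; apply: eq_bigr => j /setD1P[jc jS'].
  apply: eq_bigr => l _.
  by rewrite (@joint_rank_apart _ _ a _ (xI l) a_gt0 S S' c).
ring.
Qed.

Definition centered S r z : R := B z S r - cell_prob.

Lemma local_centered S r : local S (centered S r).
Proof. by move=> x x' xx'; rewrite /centered (local_B r xx'). Qed.

Lemma smean_centered x S r : no_ties x -> #|S| = a.+1 -> smean x (centered S r) = 0.
Proof. by move=> xI Sa; rewrite /centered smeanD smean_cst smean_B // subrr. Qed.

Lemma smean_centered_disj x S (A : {set 'I_n}) r G : no_ties x -> #|S| = a.+1 ->
  [disjoint S & A] -> local A G -> smean x (fun z => centered S r z * G z) = 0.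
Proof.
move=> xI Sa dis lG.
by rewrite (smean_indep dis (local_centered r) lG xI) smean_centered // mul0r.
Qed.

Lemma smean_centered2 x S S' c r r' : no_ties x -> #|S| = a.+1 -> #|S'| = a.+1 ->
  S :&: S' = [set c] ->
  smean x (fun z => centered S r z * centered S' r' z) = cell_cov r r'.
Proof.
move=> xI Sa S'a SS'.
transitivity (smean x (fun z => B z S r * B z S' r' +
  (- cell_prob * B z S r + (- cell_prob * B z S' r' + cell_prob ^+ 2)))).
  by apply: eq_smean => // z _; rewrite /centered; ring.
rewrite !(smeanD, smeanZ, smean_cst) (smean_BB _ _ xI Sa S'a SS') !smean_B //; ring.
Qed.

Lemma cell_prob_bounds : 0 <= cell_prob <= 1.
Proof.
rewrite /cell_prob divr_ge0 ?exprn_ge0 ?ler0n //=.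
rewrite ler_pdivrMr ?exprn_gt0 ?ltr0n // mul1r -natrX ler_nat.
by case: (d) d_gt0 => // e _; rewrite expnS leq_pmulr // expn_gt0.
Qed.

Lemma centered_le1 S r z : `|centered S r z| <= 1.
Proof.
rewrite /centered /B; have /andP[p0 p1] := cell_prob_bounds.
by case: [exists i in S, _]; rewrite ?mulr1n ?mulr0n ler_norml; lra.
Qed.

End Cells.

(** * Averages over subsets of fixed size *)

Section SubsetAverage.
Context (R : realFieldType) (n m : nat).
Context (mn : (m <= n)%N) (n_gt1 : (1 < n)%N).
Implicit Types (S : {set 'I_n}) (f g : {set 'I_n} -> R) (i j : 'I_n).

Let C_neq0 : 'C(n, m)%:R != 0 :> R.
Proof. by rewrite pnatr_eq0 -lt0n bin_gt0. Qed.

Definition avg f : R := 'C(n, m)%:R^-1 * \sum_(S : {set 'I_n} | #|S| == m) f S.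

Lemma eq_avg f g : (forall S, #|S| = m -> f S = g S) -> avg f = avg g.
Proof. by move=> fg; congr (_ * _); apply: eq_bigr => S /eqP; exact: fg. Qed.

Lemma avg_cst c : avg (fun=> c) = c.
Proof.
rewrite /avg sumr_const -[X in _ * X]mulr_natl.
have -> : #|[pred S : {set 'I_n} | #|S| == m]| = 'C(n, m).
  by have := card_draws 'I_n m; rewrite card_ord cardsE.
by rewrite mulKf.
Qed.

Lemma avgZ c f : avg (fun S => c * f S) = c * avg f.
Proof. by rewrite /avg -mulr_sumr mulrCA. Qed.

Lemma avgZr c f : avg (fun S => f S * c) = avg f * c.
Proof. by rewrite /avg -mulr_suml mulrA. Qed.

Lemma avgD f g : avg (fun S => f S + g S) = avg f + avg g.
Proof. by rewrite /avg big_split mulrDr. Qed.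

Lemma avgB f g : avg (fun S => f S - g S) = avg f - avg g.
Proof. by rewrite /avg sumrB mulrBr. Qed.

Lemma avg_sum (I : Type) (r : seq I) (P : pred I) (F : I -> {set 'I_n} -> R) :
  avg (fun S => \sum_(i <- r | P i) F i S) = \sum_(i <- r | P i) avg (F i).
Proof. by rewrite /avg exchange_big mulr_sumr. Qed.

Lemma avg_exchange (F : {set 'I_n} -> {set 'I_n} -> R) :
  avg (fun S => avg (fun S' => F S S')) = avg (fun S' => avg (fun S => F S S')).
Proof.
rewrite /avg -mulr_sumr -[in RHS]mulr_sumr; congr (_ * (_ * _)).
exact: exchange_big.
Qed.

Lemma ler_avg f g : (forall S, #|S| = m -> f S <= g S) -> avg f <= avg g.
Proof.
move=> fg; rewrite ler_wpM2l ?invr_ge0 ?ler0n //.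
by apply: ler_sum => S /eqP; exact: fg.
Qed.

Lemma norm_avg f : `|avg f| <= avg (fun S => `|f S|).
Proof.
rewrite /avg normrM ger0_norm ?invr_ge0 ?ler0n //.
by rewrite ler_wpM2l ?invr_ge0 ?ler0n // ler_norm_sum.
Qed.

Lemma avg_perm (t : 'S_n) f : avg (fun S => f (t @: S)) = avg f.
Proof.
congr (_ * _); rewrite [RHS](reindex_inj (imset_inj (@perm_inj _ t))).
by apply: eq_bigl => S; rewrite card_imset //; exact: perm_inj.
Qed.

Lemma mem_imset_tperm i j k S : (tperm i j k \in tperm i j @: S) = (k \in S).
Proof. by rewrite mem_imset //; exact: perm_inj. Qed.

Let n_neq0 : n%:R != 0 :> R. Proof. by rewrite pnatr_eq0 -lt0n ltnW. Qed.
Let n1_neq0 : n.-1%:R != 0 :> R.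
Proof. by rewrite pnatr_eq0 -lt0n; case: (n) n_gt1 => [|[]]. Qed.

Lemma sum_mem S : \sum_i (i \in S)%:R = #|S|%:R :> R.
Proof.
by rewrite -natr_sum -sum1_card [in RHS]big_mkcond.
Qed.

(** The elements of a random subset are exchangeable and m in number. *)
Lemma avg_mem i : avg (fun S => (i \in S)%:R) = m%:R / n%:R.
Proof.
have tr j : avg (fun S => (j \in S)%:R) = avg (fun S => (i \in S)%:R).
  rewrite -[LHS](avg_perm (tperm i j)); apply: eq_avg => S _.
  by rewrite -{1}(tpermL i j) mem_imset_tperm.
apply: (mulfI n_neq0); rewrite [RHS]mulrCA mulfV // mulr1.
rewrite mulr_natl -[X in _ *+ X](card_ord n) -sumr_const -(eq_bigr _ (fun j _ => tr j)).
rewrite -avg_sum -[RHS]avg_cst; apply: eq_avg => S <-.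
exact: sum_mem.
Qed.

Lemma avg_mem2 i j : i != j ->
  avg (fun S => ((i \in S) && (j \in S))%:R) = (m * m.-1)%:R / (n * n.-1)%:R.
Proof.
move=> ij.
have tr k : k \in [set~ i] -> avg (fun S => ((i \in S) && (k \in S))%:R)
                          = avg (fun S => ((i \in S) && (j \in S))%:R).
  rewrite !inE => ki; rewrite -[LHS](avg_perm (tperm j k)); apply: eq_avg => S _.
  rewrite -[in RHS](mem_imset_tperm j k i) -[in RHS](mem_imset_tperm j k j).
  by rewrite tpermL tpermD // eq_sym.
apply: (mulfI n1_neq0).
transitivity (m.-1%:R * (m%:R / n%:R) : R); last by rewrite !natrM; field; rewrite n1_neq0.
rewrite -(avg_mem i).
have -> : n.-1 = #|[set~ i]| by rewrite cardsC1 card_ord.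
transitivity (\sum_(k in [set~ i]) avg (fun S => ((i \in S) && (k \in S))%:R)).
  by rewrite (eq_bigr _ tr) sumr_const mulr_natl.
rewrite -avg_sum -avgZ; apply: eq_avg => S Sm.
case: (boolP (i \in S)) => iS; last by rewrite mulr0 big1.
rewrite mulr1 /=.
have := sum_mem (S :\ i); rewrite (_ : #|S :\ i| = m.-1); last first.
  by have := cardsD1 i S; rewrite iS Sm => ->.
move=> <-; rewrite [RHS](bigD1 i) //= !inE eqxx add0r.
by apply: eq_big => k; rewrite !inE // => ->.
Qed.

Definition inter S S' : nat := #|S :&: S'|.

Lemma interC S S' : inter S S' = inter S' S.
Proof. by rewrite /inter setIC. Qed.

Lemma avg_inter S : #|S| = m -> avg (fun S' => (inter S S')%:R) = (m ^ 2)%:R / n%:R.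
Proof.
move=> Sm.
transitivity (avg (fun S' => \sum_(i in S) (i \in S')%:R)).
  apply: eq_avg => S' _; rewrite -(sum_mem (S :&: S')) [RHS]big_mkcond.
  by apply: eq_bigr => i _; rewrite inE; case: (i \in S).
rewrite avg_sum (eq_bigr _ (fun i _ => avg_mem i)) sumr_const Sm.
by rewrite natrX -[LHS]mulr_natl mulrA expr2.
Qed.

Lemma avg_inter2 S : #|S| = m ->
  avg (fun S' => (inter S S' * (inter S S').-1)%:R) =
  ((m * m.-1) ^ 2)%:R / (n * n.-1)%:R.
Proof.
move=> Sm.
transitivity (avg (fun S' => \sum_(i in S) \sum_(j in S :\ i) ((i \in S') && (j \in S'))%:R)).
  apply: eq_avg => S' _.
  transitivity (\sum_(i in S :&: S') (inter S S').-1%:R : R).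
    by rewrite sumr_const natrM mulr_natl.
  rewrite [RHS](bigID (mem S')) /= [X in _ = _ + X]big1 ?addr0; last first.
    by move=> i /andP[_ /negPf ->]; rewrite big1.
  apply: eq_big => [i|i /setIP[iS iS']]; first by rewrite inE.
  rewrite iS' /= [in LHS](_ : (inter S S').-1 = #|(S :&: S') :\ i|); last first.
    by have := cardsD1 i (S :&: S'); rewrite inE iS iS' /inter => ->.
  rewrite -(sum_mem ((S :&: S') :\ i)) [RHS]big_mkcond; apply: eq_bigr => j _.
  by rewrite !inE; case: (j \in S); case: (j == i).
rewrite avg_sum.
under eq_bigr => i iS.
  rewrite avg_sum (eq_bigr (fun=> (m * m.-1)%:R / (n * n.-1)%:R)).
    rewrite sumr_const (_ : #|S :\ i| = m.-1); last first.
      by have := cardsD1 i S; rewrite iS Sm => ->.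
    over.
  by move=> j; rewrite !inE => /andP[ji _]; rewrite avg_mem2 // eq_sym.
rewrite sumr_const Sm -mulrnA -[LHS]mulr_natl mulrA -natrM.
by congr (_%:R / _); rewrite expnS expn1 [X in (X * _)%N]mulnC.
Qed.

Lemma inter_le S S' : #|S| = m -> (inter S S' <= m)%N.
Proof. by move=> <-; apply: subset_leq_card; apply: subsetIl. Qed.

Definition inter_moment1 : R := (m ^ 2)%:R / n%:R.
Definition inter_moment2 : R := ((m * m.-1) ^ 2)%:R / (n * n.-1)%:R.

End SubsetAverage.

(** * Moments of products of centered cells *)

(** The arguments are the sizes of the pairwise intersections of four sets.
    The terms of the first four lines are the products over spanning trees of
    the graph joining the sets that meet, each tree being split as a leaf
    attached to a path through the other three vertices; the last three lines
    detect perfect matchings where a matched pair shares two observations or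
    more. *)
Definition defect (n12 n13 n14 n23 n24 n34 : nat) : nat :=
  ((n14 + n24 + n34) * (n12 * n13 + n12 * n23 + n13 * n23)
 + (n13 + n23 + n34) * (n12 * n14 + n12 * n24 + n14 * n24)
 + (n12 + n23 + n24) * (n13 * n14 + n13 * n34 + n14 * n34)
 + (n12 + n13 + n14) * (n23 * n24 + n23 * n34 + n24 * n34)
 + (n12 * n12.-1 * n34 + n12 * (n34 * n34.-1))
 + (n13 * n13.-1 * n24 + n13 * (n24 * n24.-1))
 + (n14 * n14.-1 * n23 + n14 * (n23 * n23.-1)))%N.

(** A graph on four vertices without isolated vertex is connected or a perfect
    matching. *)
Lemma defect_eq0 n12 n13 n14 n23 n24 n34 :
  defect n12 n13 n14 n23 n24 n34 = 0%N ->
  [\/ [|| [&& n12 == 0, n13 == 0 & n14 == 0], [&& n12 == 0, n23 == 0 & n24 == 0],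
      [&& n13 == 0, n23 == 0 & n34 == 0] | [&& n14 == 0, n24 == 0 & n34 == 0]]%N,
   [&& n12 == 1, n34 == 1, n13 == 0, n14 == 0, n23 == 0 & n24 == 0]%N,
   [&& n13 == 1, n24 == 1, n12 == 0, n14 == 0, n23 == 0 & n34 == 0]%N |
   [&& n14 == 1, n23 == 1, n12 == 0, n13 == 0, n24 == 0 & n34 == 0]%N].
Proof.
move/eqP; rewrite /defect !(addn_eq0, muln_eq0).
have one k : (k == 1%N) = ~~ (k == 0%N) && (k.-1 == 0%N) by case: k => [|[]].
rewrite !one.
move: (n12 == 0%N) (n13 == 0%N) (n14 == 0%N) (n23 == 0%N) (n24 == 0%N) (n34 == 0%N).
move: (n12.-1 == 0%N) (n13.-1 == 0%N) (n14.-1 == 0%N) (n23.-1 == 0%N)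
  (n24.-1 == 0%N) (n34.-1 == 0%N).
move=> c12 c13 c14 c23 c24 c34 [] [] [] [] [] [] //=;
  rewrite ?(andbT, orbF, andbF, orbT) => h //;
  by [constructor 1 | constructor 2; case/andP: h => -> -> |
      constructor 3; case/andP: h => -> -> | constructor 4; case/andP: h => -> ->].
Qed.

Lemma disjointUr (T : finType) (A X Y : {set T}) :
  [disjoint A & X :|: Y] = [disjoint A & X] && [disjoint A & Y].
Proof. by rewrite -!setI_eq0 setIUr setU_eq0. Qed.

Section MomentBounds.
Context (R : realType) (d n a : nat).
Context (d_gt0 : (0 < d)%N) (a_gt0 : (0 < a)%N).
Context (x : 'I_n -> d.-tuple R) (xI : no_ties x).
Implicit Types (S : {set 'I_n}) (r : {ffun 'I_d -> 'I_a.+1}).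
Notation centered := (@centered R d n a).
Notation cell_cov := (@cell_cov R d a).

Definition moment2 S1 S2 r1 r2 : R := smean x (fun z => centered S1 r1 z * centered S2 r2 z).

Definition moment4 S1 S2 S3 S4 r1 r2 r3 r4 : R :=
  smean x (fun z =>
    centered S1 r1 z * (centered S2 r2 z * (centered S3 r3 z * centered S4 r4 z))).

Lemma inter_eq0 S S' : (inter S S' == 0%N) = [disjoint S & S'].
Proof. by rewrite /inter cards_eq0 setI_eq0. Qed.

Lemma moment2_disj S1 S2 r1 r2 : #|S1| = a.+1 -> inter S1 S2 = 0%N -> moment2 S1 S2 r1 r2 = 0.
Proof.
move=> c1 /eqP; rewrite inter_eq0 => dis.
exact: (smean_centered_disj d_gt0 _ xI c1 dis (@local_centered _ _ _ _ _ _)).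
Qed.

Lemma moment2_inter1 S1 S2 r1 r2 : #|S1| = a.+1 -> #|S2| = a.+1 -> inter S1 S2 = 1%N ->
  moment2 S1 S2 r1 r2 = cell_cov r1 r2.
Proof.
move=> c1 c2 /eqP/cards1P[c cE].
exact: (smean_centered2 d_gt0 a_gt0 _ _ xI c1 c2 cE).
Qed.

Lemma moment2_le1 S1 S2 r1 r2 : `|moment2 S1 S2 r1 r2| <= 1.
Proof.
apply: smean_norm_le => // z _; rewrite normrM -[leRHS]mulr1.
by rewrite ler_pM ?centered_le1.
Qed.

(** Both terms vanish on disjoint sets and agree when the sets share one
    observation. *)
Lemma moment2_bound S1 S2 r1 r2 : #|S1| = a.+1 -> #|S2| = a.+1 ->
  `|moment2 S1 S2 r1 r2 - (inter S1 S2)%:R * cell_cov r1 r2| <=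
  (1 + `|cell_cov r1 r2|) * (inter S1 S2 * (inter S1 S2).-1)%:R.
Proof.
move=> c1 c2; have e0 := @moment2_disj S1 S2 r1 r2 c1.
have e1 := @moment2_inter1 S1 S2 r1 r2 c1 c2.
have le1 := @moment2_le1 S1 S2 r1 r2.
case: (inter S1 S2) e0 e1 => [/(_ erefl) -> _|[_ /(_ erefl) ->|k _ _]].
- by rewrite !mul0r subr0 normr0 mulr0.
- by rewrite mul1r subrr normr0 mulr0.
apply: le_trans (ler_normB _ _) _.
rewrite [`|_ * cell_cov _ _|]normrM normr_nat [leRHS]mulrDl mul1r.
have k2 : (k.+2 <= k.+2 * k.+1)%N by rewrite leq_pmulr.
rewrite [k.+2.-1]/=; apply: lerD.
  by apply: le_trans le1 _; rewrite -[1]/(1%:R) ler_nat muln_gt0.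
by rewrite mulrC ler_wpM2l // ler_nat.
Qed.

Lemma moment4_le1 S1 S2 S3 S4 r1 r2 r3 r4 : `|moment4 S1 S2 S3 S4 r1 r2 r3 r4| <= 1.
Proof.
apply: smean_norm_le => // z _.
by rewrite !normrM !mulr_ile1 ?mulr_ge0 ?centered_le1.
Qed.

Lemma moment4_isolated S1 S2 S3 S4 r1 r2 r3 r4 : #|S1| = a.+1 ->
  inter S1 S2 = 0%N -> inter S1 S3 = 0%N -> inter S1 S4 = 0%N ->
  moment4 S1 S2 S3 S4 r1 r2 r3 r4 = 0.
Proof.
move=> c1 /eqP; rewrite inter_eq0 => d2 /eqP; rewrite inter_eq0 => d3 /eqP.
rewrite inter_eq0 => d4.
apply: (@smean_centered_disj _ _ _ _ d_gt0 _ _ (S2 :|: (S3 :|: S4)) _ _ xI c1).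
  by rewrite !disjointUr d2 d3.
apply: localM; first exact/localS/local_centered/subsetUl.
apply: localM; apply/localS/local_centered.
  exact: subset_trans (subsetUl _ _) (subsetUr _ _).
exact: subset_trans (subsetUr _ _) (subsetUr _ _).
Qed.

Lemma moment4_match S1 S2 S3 S4 r1 r2 r3 r4 :
  inter S1 S3 = 0%N -> inter S1 S4 = 0%N -> inter S2 S3 = 0%N -> inter S2 S4 = 0%N ->
  moment4 S1 S2 S3 S4 r1 r2 r3 r4 = moment2 S1 S2 r1 r2 * moment2 S3 S4 r3 r4.
Proof.
move=> /eqP; rewrite inter_eq0 => d13 /eqP; rewrite inter_eq0 => d14.
move=> /eqP; rewrite inter_eq0 => d23 /eqP; rewrite inter_eq0 => d24.
rewrite /moment4 /moment2 -(@smean_indep _ _ _ (S1 :|: S2) (S3 :|: S4)) //.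
- by congr (smean x _); apply/funext => z; rewrite mulrA.
- rewrite disjointUr ![[disjoint _ :|: _ & _]]disjoint_sym !disjointUr.
  by rewrite !(disjoint_sym _ S1) !(disjoint_sym _ S2) d13 d23 d14.
- by apply: localM; apply/localS/local_centered; [apply: subsetUl|apply: subsetUr].
- by apply: localM; apply/localS/local_centered; [apply: subsetUl|apply: subsetUr].
Qed.

Lemma moment4_swap12 S1 S2 S3 S4 r1 r2 r3 r4 :
  moment4 S1 S2 S3 S4 r1 r2 r3 r4 = moment4 S2 S1 S3 S4 r2 r1 r3 r4.
Proof. by congr (smean x _); apply/funext => z; rewrite mulrCA. Qed.

Lemma moment4_swap23 S1 S2 S3 S4 r1 r2 r3 r4 :
  moment4 S1 S2 S3 S4 r1 r2 r3 r4 = moment4 S1 S3 S2 S4 r1 r3 r2 r4.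
Proof. by congr (smean x _); apply/funext => z; rewrite [centered S2 _ _ * _]mulrCA. Qed.

Lemma moment4_swap34 S1 S2 S3 S4 r1 r2 r3 r4 :
  moment4 S1 S2 S3 S4 r1 r2 r3 r4 = moment4 S1 S2 S4 S3 r1 r2 r4 r3.
Proof. by congr (smean x _); apply/funext => z; rewrite [centered S3 _ _ * _]mulrC. Qed.

Definition pairing_sum S1 S2 S3 S4 r1 r2 r3 r4 : R :=
  (inter S1 S2 * inter S3 S4)%:R * (cell_cov r1 r2 * cell_cov r3 r4) +
  (inter S1 S3 * inter S2 S4)%:R * (cell_cov r1 r3 * cell_cov r2 r4) +
  (inter S1 S4 * inter S2 S3)%:R * (cell_cov r1 r4 * cell_cov r2 r3).

Definition defect_of S1 S2 S3 S4 : nat :=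
  defect (inter S1 S2) (inter S1 S3) (inter S1 S4) (inter S2 S3) (inter S2 S4) (inter S3 S4).

Definition moment4_const r1 r2 r3 r4 : R := (a.+1 ^ 2)%:R *
  (1 + `|cell_cov r1 r2 * cell_cov r3 r4| + `|cell_cov r1 r3 * cell_cov r2 r4|
     + `|cell_cov r1 r4 * cell_cov r2 r3|).

Lemma moment4_const_ge0 r1 r2 r3 r4 : 0 <= moment4_const r1 r2 r3 r4.
Proof. by rewrite mulr_ge0 ?ler0n // !addr_ge0. Qed.

(** When the defect is zero, either a set is isolated and both terms vanish, or
    the sets are matched in pairs sharing one observation and both are the
    product of two covariances. *)
Lemma moment4_bound S1 S2 S3 S4 r1 r2 r3 r4 :
  #|S1| = a.+1 -> #|S2| = a.+1 -> #|S3| = a.+1 -> #|S4| = a.+1 ->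
  `|moment4 S1 S2 S3 S4 r1 r2 r3 r4 - pairing_sum S1 S2 S3 S4 r1 r2 r3 r4| <=
  moment4_const r1 r2 r3 r4 * (defect_of S1 S2 S3 S4)%:R.
Proof.
move=> c1 c2 c3 c4.
have [D0|D0] := eqVneq (defect_of S1 S2 S3 S4) 0%N; last first.
  apply: (@le_trans _ _ (moment4_const r1 r2 r3 r4)); last first.
    by rewrite ler_peMr ?moment4_const_ge0 // -[1]/(1%:R) ler_nat lt0n.
  (* the defect is at least 1 here: a crude bound by constants suffices *)
  apply: le_trans (ler_normB _ _) _.
  have i2 S S' (T T' : {set 'I_n}) (u : R) : #|S| = a.+1 -> #|T| = a.+1 ->
      `|(inter S S' * inter T T')%:R * u| <= (a.+1 ^ 2)%:R * `|u|.
    move=> Sa Ta; rewrite normrM normr_nat ler_wpM2r // ler_nat expnS expn1.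
    by rewrite leq_mul // inter_le.
  rewrite /pairing_sum /moment4_const.
  move: (cell_cov r1 r2 * _) (cell_cov r1 r3 * _) (cell_cov r1 r4 * _) => u v w.
  rewrite !mulrDr mulr1 -!addrA; apply: lerD.
    by apply: le_trans (@moment4_le1 _ _ _ _ _ _ _ _) _; rewrite -[1]/(1%:R) ler_nat expn_gt0.
  apply: le_trans (ler_normD _ _) _.
  apply: lerD; first exact: i2.
  by apply: le_trans (ler_normD _ _) _; apply: lerD; apply: i2.
rewrite D0 mulr0.
suff -> : moment4 S1 S2 S3 S4 r1 r2 r3 r4 = pairing_sum S1 S2 S3 S4 r1 r2 r3 r4.
  by rewrite subrr normr0.
rewrite /pairing_sum; case: (defect_eq0 D0).
- case/or4P => /and3P[/eqP h1 /eqP h2 /eqP h3]; rewrite h1 h2 h3 ?(mul0n, muln0) !mul0r !addr0.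
  + by rewrite moment4_isolated.
  + by rewrite moment4_swap12 moment4_isolated // interC.
  + by rewrite moment4_swap23 moment4_swap12 moment4_isolated // interC.
  + by rewrite moment4_swap34 moment4_swap23 moment4_swap12 moment4_isolated // interC.
- case/and5P => /eqP h12 /eqP h34 /eqP h13 /eqP h14 /andP[/eqP h23 /eqP h24].
  by rewrite h12 h34 h13 h14 mul1r !mul0r !addr0 moment4_match // !moment2_inter1.
- case/and5P => /eqP h13 /eqP h24 /eqP h12 /eqP h14 /andP[/eqP h23 /eqP h34].
  rewrite h13 h24 h12 h14 mul1r !mul0r add0r addr0 moment4_swap23 moment4_match //.
    by rewrite !moment2_inter1.
  by rewrite interC.
- case/and5P => /eqP h14 /eqP h23 /eqP h12 /eqP h13 /andP[/eqP h24 /eqP h34].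
  rewrite h14 h23 h12 h13 mul1r !mul0r !add0r moment4_swap34 moment4_swap23.
  by rewrite moment4_match ?moment2_inter1 // interC.
Qed.

End MomentBounds.

(** * Moments of the statistic *)

Section AveragedMoments.
Context (R : realType) (d n a : nat).
Context (d_gt0 : (0 < d)%N) (a_gt0 : (0 < a)%N) (an : (a.+1 <= n)%N).
Context (x : 'I_n -> d.-tuple R) (xI : no_ties x).
Implicit Types (S : {set 'I_n}) (r : {ffun 'I_d -> 'I_a.+1}) (z : 'I_n -> d.-tuple R).
Notation centered := (@centered R d n a).
Notation cell_cov := (@cell_cov R d a).
Notation avg := (@avg R n a.+1).
Notation mu := (inter_moment1 R n a.+1).
Notation nu := (inter_moment2 R n a.+1).
Let n_gt1 : (1 < n)%N. Proof. exact: leq_trans an. Qed.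

Definition avg4 (f : {set 'I_n} -> {set 'I_n} -> {set 'I_n} -> {set 'I_n} -> R) : R :=
  avg (fun S1 => avg (fun S2 => avg (fun S3 => avg (fun S4 => f S1 S2 S3 S4)))).

Lemma eq_avg4 f g : (forall S1 S2 S3 S4, #|S1| = a.+1 -> #|S2| = a.+1 ->
    #|S3| = a.+1 -> #|S4| = a.+1 -> f S1 S2 S3 S4 = g S1 S2 S3 S4) -> avg4 f = avg4 g.
Proof. by move=> fg; do 4 (apply: eq_avg => ? ?); exact: fg. Qed.

Lemma avg4D f g :
  avg4 (fun S1 S2 S3 S4 => f S1 S2 S3 S4 + g S1 S2 S3 S4) = avg4 f + avg4 g.
Proof.
rewrite /avg4 -avgD; apply: eq_avg => S1 _; rewrite -avgD; apply: eq_avg => S2 _.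
by rewrite -avgD; apply: eq_avg => S3 _; rewrite -avgD.
Qed.

Lemma avg4Zr c f : avg4 (fun S1 S2 S3 S4 => f S1 S2 S3 S4 * c) = avg4 f * c.
Proof.
rewrite /avg4 -avgZr; apply: eq_avg => S1 _; rewrite -avgZr; apply: eq_avg => S2 _.
by rewrite -avgZr; apply: eq_avg => S3 _; rewrite -avgZr.
Qed.

Lemma avg4Z c f : avg4 (fun S1 S2 S3 S4 => c * f S1 S2 S3 S4) = c * avg4 f.
Proof. by rewrite mulrC -avg4Zr; apply: eq_avg4 => *; rewrite mulrC. Qed.

Lemma norm_avg4_le f g : (forall S1 S2 S3 S4, #|S1| = a.+1 -> #|S2| = a.+1 ->
    #|S3| = a.+1 -> #|S4| = a.+1 -> `|f S1 S2 S3 S4| <= g S1 S2 S3 S4) ->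
  `|avg4 f| <= avg4 g.
Proof.
move=> fg; rewrite /avg4; do 3 (apply: le_trans (norm_avg _ _) _; apply: ler_avg => ? ?).
by apply: le_trans (norm_avg _ _) _; apply: ler_avg => ? ?; exact: fg.
Qed.

Lemma avg4_swap34 f : avg4 f = avg4 (fun S1 S2 S3 S4 => f S1 S2 S4 S3).
Proof. by do 2 (apply: eq_avg => ? _); exact: avg_exchange. Qed.

Lemma avg4_swap23 f : avg4 f = avg4 (fun S1 S2 S3 S4 => f S1 S3 S2 S4).
Proof. by apply: eq_avg => ? _; exact: avg_exchange. Qed.

Lemma avg4_swap12 f : avg4 f = avg4 (fun S1 S2 S3 S4 => f S2 S1 S3 S4).
Proof. exact: avg_exchange. Qed.

Let I S S' : R := (inter S S')%:R.
Let J S S' : R := (inter S S' * (inter S S').-1)%:R.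

Lemma avgI S : #|S| = a.+1 -> avg (I S) = mu.
Proof. exact: avg_inter. Qed.

Lemma avgJ S : #|S| = a.+1 -> avg (J S) = nu.
Proof. exact: avg_inter2. Qed.

Let IC S S' : I S S' = I S' S. Proof. by rewrite /I interC. Qed.

(** The mean of #|S :&: S4| over S4 does not depend on S, hence a leaf of a tree
    can be integrated first. *)
Lemma avg4_leaf (g : {set 'I_n} -> {set 'I_n} -> {set 'I_n} -> R) :
  avg4 (fun S1 S2 S3 S4 => (I S1 S4 + I S2 S4 + I S3 S4) * g S1 S2 S3) =
  3 * mu * avg (fun S1 => avg (fun S2 => avg (fun S3 => g S1 S2 S3))).
Proof.
rewrite -avgZ; apply: eq_avg => S1 c1; rewrite -avgZ; apply: eq_avg => S2 c2.
rewrite -avgZ; apply: eq_avg => S3 c3; rewrite avgZr !avgD !avgI //.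
by congr (_ * _); ring.
Qed.

Lemma avg3_path :
  avg (fun S1 => avg (fun S2 => avg (fun S3 =>
    I S1 S2 * I S1 S3 + I S1 S2 * I S2 S3 + I S1 S3 * I S2 S3))) = 3 * mu ^+ 2.
Proof.
have h1 : avg (fun S1 => avg (fun S2 => avg (fun S3 =>
    I S1 S2 * I S1 S3 + I S1 S2 * I S2 S3))) = 2 * mu ^+ 2.
  rewrite -[RHS](avg_cst an); apply: eq_avg => S1 c1.
  transitivity (avg (fun S2 => I S1 S2 * (2 * mu))).
    by apply: eq_avg => S2 c2; rewrite avgD !avgZ !avgI //; ring.
  by rewrite avgZr avgI //; ring.
have h2 : avg (fun S1 => avg (fun S2 => avg (fun S3 => I S1 S3 * I S2 S3))) = mu ^+ 2.
  rewrite -[RHS](avg_cst an); apply: eq_avg => S1 c1.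
  rewrite avg_exchange expr2 -{1}(avgI c1) -avgZr.
  apply: eq_avg => S3 c3; rewrite avgZ; congr (_ * _).
  by rewrite -(avgI c3); apply: eq_avg => S2 _; rewrite IC.
transitivity (2 * mu ^+ 2 + mu ^+ 2); last by ring.
rewrite -h1 -h2 -avgD; apply: eq_avg => S1 _; rewrite -avgD; apply: eq_avg => S2 _.
by rewrite -avgD.
Qed.

Let tree S1 S2 S3 S4 : R := (I S1 S4 + I S2 S4 + I S3 S4) *
   (I S1 S2 * I S1 S3 + I S1 S2 * I S2 S3 + I S1 S3 * I S2 S3).

Let avg4_tree : avg4 tree = 9 * mu ^+ 3.
Proof. by rewrite avg4_leaf avg3_path; ring. Qed.

Lemma avg4_matching (f g : {set 'I_n} -> {set 'I_n} -> R) (u v : R) :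
  (forall S, #|S| = a.+1 -> avg (f S) = u) -> (forall S, #|S| = a.+1 -> avg (g S) = v) ->
  [/\ avg4 (fun S1 S2 S3 S4 => f S1 S2 * g S3 S4) = u * v,
      avg4 (fun S1 S2 S3 S4 => f S1 S3 * g S2 S4) = u * v &
      avg4 (fun S1 S2 S3 S4 => f S1 S4 * g S2 S3) = u * v].
Proof.
move=> fu gv.
have h : avg4 (fun S1 S2 S3 S4 => f S1 S2 * g S3 S4) = u * v.
  rewrite -[RHS](avg_cst an); apply: eq_avg => S1 c1.
  rewrite -(fu _ c1) -avgZr; apply: eq_avg => S2 c2.
  rewrite -[RHS](avg_cst an); apply: eq_avg => S3 c3.
  by rewrite avgZ gv.
split=> //; first by rewrite -h [LHS]avg4_swap23.
by rewrite -h [LHS]avg4_swap34 [LHS]avg4_swap23.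
Qed.

Lemma avg4_defect :
  avg4 (fun S1 S2 S3 S4 => (defect_of S1 S2 S3 S4)%:R) = 36 * mu ^+ 3 + 6 * (mu * nu).
Proof.
have [m12 m13 m14] := avg4_matching avgJ avgI.
have [m12' m13' m14'] := avg4_matching avgI avgJ.
have t4 := avg4_tree.
have t3 : avg4 (fun S1 S2 S3 S4 => tree S1 S2 S4 S3) = 9 * mu ^+ 3.
  by rewrite -avg4_swap34.
have t2 : avg4 (fun S1 S2 S3 S4 => tree S1 S3 S4 S2) = 9 * mu ^+ 3.
  by rewrite avg4_swap23 -t3.
have t1 : avg4 (fun S1 S2 S3 S4 => tree S2 S3 S4 S1) = 9 * mu ^+ 3.
  by rewrite avg4_swap12 -t2.
transitivity (9 * mu ^+ 3 + 9 * mu ^+ 3 + 9 * mu ^+ 3 + 9 * mu ^+ 3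
  + (nu * mu + mu * nu) + (nu * mu + mu * nu) + (nu * mu + mu * nu)); last by ring.
rewrite -{1}t4 -{1}t3 -{1}t2 -t1 -{1}m12 -{1}m12' -{1}m13 -{1}m13' -m14 -m14' -!avg4D.
apply: eq_avg4 => S1 S2 S3 S4 _ _ _ _.
rewrite /defect_of /defect /tree /J /I !(natrD, natrM) !(interC S2 S1, interC S3 S1).
by rewrite !(interC S4 S1, interC S3 S2, interC S4 S2, interC S4 S3); ring.
Qed.

Lemma avg_moment2_bound r r' :
  `|avg (fun S1 => avg (fun S2 => moment2 x S1 S2 r r')) - mu * cell_cov r r'| <=
  (1 + `|cell_cov r r'|) * nu.
Proof.
have -> : mu * cell_cov r r' = avg (fun S1 => avg (fun S2 => I S1 S2 * cell_cov r r')).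
  rewrite -[LHS](avg_cst an); apply: eq_avg => S1 c1.
  by rewrite avgZr avgI.
have -> : (1 + `|cell_cov r r'|) * nu =
    avg (fun S1 => avg (fun S2 => (1 + `|cell_cov r r'|) * J S1 S2)).
  rewrite -[LHS](avg_cst an); apply: eq_avg => S1 c1.
  by rewrite avgZ avgJ.
rewrite -avgB; apply: le_trans (norm_avg _ _) _; apply: ler_avg => S1 c1.
rewrite -avgB; apply: le_trans (norm_avg _ _) _; apply: ler_avg => S2 c2.
exact: moment2_bound.
Qed.

Lemma avg_moment4_bound r1 r2 r3 r4 :
  `|avg4 (fun S1 S2 S3 S4 => moment4 x S1 S2 S3 S4 r1 r2 r3 r4) -
    mu ^+ 2 * (cell_cov r1 r2 * cell_cov r3 r4 + cell_cov r1 r3 * cell_cov r2 r4 +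
               cell_cov r1 r4 * cell_cov r2 r3)| <=
  moment4_const R r1 r2 r3 r4 * (36 * mu ^+ 3 + 6 * (mu * nu)).
Proof.
have [m12 m13 m14] := avg4_matching avgI avgI.
have -> : mu ^+ 2 * (cell_cov r1 r2 * cell_cov r3 r4 + cell_cov r1 r3 * cell_cov r2 r4 +
                     cell_cov r1 r4 * cell_cov r2 r3) =
  avg4 (fun S1 S2 S3 S4 => pairing_sum R S1 S2 S3 S4 r1 r2 r3 r4).
  rewrite /pairing_sum.
  move: (cell_cov r1 r2 * _) (cell_cov r1 r3 * _) (cell_cov r1 r4 * _) => u v w.
  rewrite !avg4D !avg4Zr expr2 !mulrDr -{1}m12 -{1}m13 -m14.
  by congr (avg4 _ * _ + avg4 _ * _ + avg4 _ * _); do 4 (apply/funext => ?); rewrite natrM.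
rewrite -avg4_defect -avg4Z -mulN1r -avg4Z -avg4D; apply: norm_avg4_le => S1 S2 S3 S4 *.
by rewrite mulN1r; apply: moment4_bound.
Qed.

(** The statistic, with the reference probabilities which hold under
    independence. *)
Definition T_indep z : R :=
  T_stat (fun _ : {ffun 'I_d -> 'I_a.+1} => a.+1%:R^-1 * cell_prob R d a) z.

Lemma T_stat_avg z : T_indep z =
  (a.+1%:R ^+ d / a.+1%:R ^+ 2) * \sum_r avg (fun S => centered S r z) ^+ 2.
Proof.
rewrite /T_indep /T_stat -mulrA; congr (_ * _); rewrite mulr_sumr; apply: eq_bigr => r _.
rewrite -exprVn -exprMn; congr (_ ^+ 2).
rewrite /centered avgB // avg_cst // mulrBr; congr (_ - _).
by rewrite /Phat /avg invfM mulrA.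
Qed.

Lemma avg_sqr (f : {set 'I_n} -> R) :
  avg f ^+ 2 = avg (fun S1 => avg (fun S2 => f S1 * f S2)).
Proof. by rewrite expr2 -avgZr; apply: eq_avg => S1 _; rewrite avgZ. Qed.

Lemma avg_sqr_sqr (f g : {set 'I_n} -> R) :
  avg f ^+ 2 * avg g ^+ 2 = avg4 (fun S1 S2 S3 S4 => f S1 * (f S2 * (g S3 * g S4))).
Proof.
rewrite !avg_sqr -avgZr; apply: eq_avg => S1 _.
rewrite -avgZr; apply: eq_avg => S2 _.
rewrite -avgZ; apply: eq_avg => S3 _.
by rewrite -avgZ; apply: eq_avg => S4 _; rewrite !mulrA.
Qed.

Lemma smean_avg (F : {set 'I_n} -> ('I_n -> d.-tuple R) -> R) :
  smean x (fun z => avg (fun S => F S z)) = avg (fun S => smean x (F S)).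
Proof. by rewrite /avg smeanZ smean_sum. Qed.

Lemma smean_T : smean x (T_indep) =
  (a.+1%:R ^+ d / a.+1%:R ^+ 2) *
  \sum_(r : {ffun 'I_d -> 'I_a.+1}) avg (fun S1 => avg (fun S2 => moment2 x S1 S2 r r)).
Proof.
rewrite (_ : T_indep = fun z => (a.+1%:R ^+ d / a.+1%:R ^+ 2) *
   \sum_r avg (fun S => centered S r z) ^+ 2); last first.
  by apply/funext => z; exact: T_stat_avg.
rewrite smeanZ smean_sum; congr (_ * _); apply: eq_bigr => r _.
under [in LHS]eq_fun do rewrite avg_sqr.
by rewrite smean_avg; apply: eq_avg => S1 _; rewrite smean_avg.
Qed.

Lemma smean_T_sqr : smean x (fun z => T_indep z ^+ 2) =
  (a.+1%:R ^+ d / a.+1%:R ^+ 2) ^+ 2 *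
  \sum_(r : {ffun 'I_d -> 'I_a.+1}) \sum_(r' : {ffun 'I_d -> 'I_a.+1})
    avg4 (fun S1 S2 S3 S4 => moment4 x S1 S2 S3 S4 r r r' r').
Proof.
rewrite (_ : (fun z => _) = fun z => (a.+1%:R ^+ d / a.+1%:R ^+ 2) ^+ 2 *
   \sum_r \sum_r' avg4 (fun S1 S2 S3 S4 =>
     centered S1 r z * (centered S2 r z * (centered S3 r' z * centered S4 r' z)))); last first.
  apply/funext => z; rewrite T_stat_avg exprMn; congr (_ * _).
  rewrite expr2 mulr_suml; apply: eq_bigr => r _; rewrite mulr_sumr.
  by apply: eq_bigr => r' _; rewrite avg_sqr_sqr.
rewrite smeanZ smean_sum; congr (_ * _); apply: eq_bigr => r _.
rewrite smean_sum; apply: eq_bigr => r' _.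
by rewrite smean_avg; apply: eq_avg => S1 _; rewrite smean_avg; apply: eq_avg => S2 _;
  rewrite smean_avg; apply: eq_avg => S3 _; rewrite smean_avg.
Qed.

End AveragedMoments.

(** * Evaluation of the limits *)

Section ClosedForms.
Context (R : realType) (d a : nat).
Context (d_gt0 : (0 < d)%N) (a_gt0 : (0 < a)%N).
Notation cell_cov := (@cell_cov R d a).
Notation M := (a.+1%:R : R).
Notation q := (rank_joint R a).
Implicit Types (r : {ffun 'I_d -> 'I_a.+1}).

Let M_neq0 : M != 0. Proof. by rewrite pnatr_eq0. Qed.
Let a_neq0 : a%:R != 0 :> R. Proof. by rewrite pnatr_eq0 -lt0n. Qed.
Let M1 : M - 1 = a%:R. Proof. by rewrite -natr1 addrK. Qed.

(** In this form the sums over ranks are the two convolutions evaluated above. *)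
Lemma rank_jointE k k' : (k <= a)%N -> (k' <= a)%N ->
  q k k' = ('C(k + k', k) * 'C(2 * a - (k + k'), a - k))%:R /
           ((2 * a).+1 * 'C(2 * a, a))%:R.
Proof.
move=> ka k'a; rewrite /rank_joint.
have C0 i : (i <= 2 * a)%N -> 'C(2 * a, i)%:R != 0 :> R.
  by move=> h; rewrite pnatr_eq0 -lt0n bin_gt0.
have key : ('C(a, k) * 'C(a, k') * 'C(2 * a, a) =
  'C(2 * a, k + k') * ('C(k + k', k) * 'C(2 * a - (k + k'), a - k)))%N.
  have f1 := bin_fact ka; have f2 := bin_fact k'a.
  have f3 := @bin_fact (2 * a) a ltac:(lia).
  have f4 := @bin_fact (2 * a) (k + k') ltac:(lia).
  have f5 := @bin_fact (k + k') k ltac:(lia).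
  have f6 := @bin_fact (2 * a - (k + k')) (a - k) ltac:(lia).
  move: f3 f5 f6; rewrite (_ : 2 * a - a = a)%N; last by lia.
  rewrite addKn (_ : 2 * a - (k + k') - (a - k) = a - k')%N; last by lia.
  move=> f3 f5 f6.
  have P0 : (0 < (k`! * (a - k)`!) * (k'`! * (a - k')`!))%N by rewrite !muln_gt0 !fact_gt0.
  apply/eqP; rewrite -(eqn_pmul2r P0); apply/eqP.
  transitivity ((2 * a)`!)%N.
    by rewrite -f3 -{1}f1 -f2; ring.
  by rewrite -f4 -f5 -f6; ring.
have e : 'C(a, k)%:R * 'C(a, k')%:R * 'C(2 * a, a)%:R =
  'C(2 * a, k + k')%:R * ('C(k + k', k)%:R * 'C(2 * a - (k + k'), a - k)%:R) :> R.
  by rewrite -!natrM key.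
have c1 := C0 (k + k')%N ltac:(lia); have c2 := C0 a ltac:(lia).
have n0 : (2 * a).+1%:R != 0 :> R by rewrite pnatr_eq0.
rewrite !natrM; apply/eqP; rewrite eqr_div ?mulf_neq0 //; apply/eqP.
by rewrite [LHS]mulrCA e; ring.
Qed.

Lemma sum_q_diag : \sum_(k < a.+1) q k k = S1 R a.+1 / M.
Proof.
under eq_bigr => k _ do rewrite rank_jointE -1?ltnS //.
rewrite -mulr_suml -natr_sum.
rewrite (eq_bigr (fun k : 'I_a.+1 => 'C(2 * k, k) * 'C(2 * (a - k), a - k))%N); last first.
  by move=> k _; rewrite addnn -mul2n mulnBr.
rewrite sum_central_bin /S1 subn1 /=.
have -> : (2 * a.+1 - 1 = (2 * a).+1)%N by lia.
have -> : (2 * a.+1 - 2 = 2 * a)%N by lia.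
by rewrite [(a.+1 * _)%:R]natrM [RHS]mulrAC [M * _]mulrC mulfK.
Qed.

Lemma sum_q : \sum_(k < a.+1) \sum_(k' < a.+1) q k k' = 1.
Proof.
under eq_bigr => k _ do rewrite sum_rank_joint -1?ltnS //.
by rewrite sumr_const card_ord -[LHS]mulr_natl mulfV.
Qed.

Lemma sum_q_sqr : \sum_(k < a.+1) \sum_(k' < a.+1) q k k' ^+ 2 = S2 R a.+1 / M ^+ 2.
Proof.
have D0 : ((2 * a).+1 * 'C(2 * a, a))%:R != 0 :> R.
  by rewrite pnatr_eq0 -lt0n muln_gt0 bin_gt0; lia.
rewrite (eq_bigr (fun k : 'I_a.+1 => \sum_(k' < a.+1)
   (('C(k + k', k) * 'C(2 * a - (k + k'), a - k)) ^ 2)%:R /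
   ((2 * a).+1 * 'C(2 * a, a))%:R ^+ 2)); last first.
  move=> k _; apply: eq_bigr => k' _.
  by rewrite rank_jointE -1?ltnS // expr_div_n [in RHS]natrX.
under eq_bigr do rewrite -mulr_suml -natr_sum.
rewrite -mulr_suml -natr_sum sum_sqr_bin_bin /S2.
have -> : (2 * a.+1 - 1 = (2 * a).+1)%N by lia.
have -> : (2 * a.+1 - 2 = 2 * a)%N by lia.
have -> : (4 * a.+1 - 3 = 4 * a + 1)%N by lia.
have -> : (a.+1 - 1 = a)%N by lia.
rewrite [(a.+1 ^ 2 * _)%:R]natrM natrX [(_ ^ 2)%:R]natrX.
move: D0 M_neq0; move: (_%:R) (M) => D m D0 m0.
by field; rewrite D0 m0.
Qed.

(** A sum over cells of a product over coordinates factors. *)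
Lemma sum_qprod_diag (f : nat -> nat -> R) :
  \sum_(r : {ffun 'I_d -> 'I_a.+1}) qprod f r r = (\sum_(k < a.+1) f k k) ^+ d.
Proof.
rewrite -[in RHS](card_ord d) -prodr_const.
by rewrite (bigA_distr_bigA (fun _ (k : 'I_a.+1) => f k k)).
Qed.

Lemma sum_qprod (f : nat -> nat -> R) :
  \sum_(r : {ffun 'I_d -> 'I_a.+1}) \sum_r' qprod f r (r' : {ffun 'I_d -> 'I_a.+1}) =
  (\sum_(k < a.+1) \sum_(k' < a.+1) f k k') ^+ d.
Proof.
transitivity (\sum_(r : {ffun 'I_d -> 'I_a.+1}) \prod_l \sum_(k' < a.+1) f (r l) k').
  by apply: eq_bigr => r _; rewrite (bigA_distr_bigA (fun l (k' : 'I_a.+1) => f (r l) k')).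
rewrite -[in RHS](card_ord d) -prodr_const.
by rewrite (bigA_distr_bigA (fun _ (k : 'I_a.+1) => \sum_(k' < a.+1) f k k')).
Qed.

Lemma qprodM (f g : nat -> nat -> R) r r' :
  qprod f r r' * qprod g r r' = qprod (fun k k' => f k k' * g k k') r r'.
Proof. by rewrite /qprod big_split. Qed.

Lemma sum_cell_prob_sqr :
  \sum_(r : {ffun 'I_d -> 'I_a.+1}) cell_prob R d a ^+ 2 = M ^+ 2 / M ^+ d.
Proof.
rewrite sumr_const card_ffun !card_ord -[LHS]mulr_natl natrX /cell_prob.
have Md : M ^+ d != 0 by rewrite expf_neq0.
by field; rewrite Md.
Qed.

Lemma lim_meanE : M ^+ d * \sum_r cell_cov r r = lim_mean R d a.+1.
Proof.
rewrite /cell_cov sumrB sum_cell_prob_sqr !big_split /= -!mulr_sumr !sum_qprod_diag.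
have mix : \sum_(k < a.+1) rank_mixed R a k k = (M - S1 R a.+1) / a%:R / M.
  rewrite /rank_mixed -mulr_suml sumrB sum_q_diag sumr_const card_ord -[_^-1 *+ _]mulr_natl.
  rewrite mulfV //; move: M_neq0; move: (M) => m m0.
  by field; rewrite m0 a_neq0.
have dis : \sum_(k < a.+1) rank_apart R a k k =
    (M ^+ 2 - 2 * M + S1 R a.+1) / a%:R ^+ 2 / M.
  rewrite /rank_apart -mulr_suml big_split /= sum_q_diag sumr_const card_ord.
  rewrite -[(_ - _) *+ _]mulr_natl.
  by move: M_neq0; move: (M) => m m0; field; rewrite m0 a_neq0.
rewrite mix dis sum_q_diag /lim_mean M1.
have Md : M ^+ d != 0 by rewrite expf_neq0.
rewrite ![(_ / M) ^+ d]expr_div_n.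
move: Md; move: (M ^+ d) (M) => md m md0.
by field; rewrite md0.
Qed.

Lemma sum_rank_mixed : \sum_(k < a.+1) \sum_(k' < a.+1) rank_mixed R a k k' = 1.
Proof.
rewrite /rank_mixed; under eq_bigr do rewrite -mulr_suml sumrB sumr_const card_ord.
rewrite -mulr_suml sumrB sum_q sumr_const card_ord -!mulrnA -[_^-1 *+ _]mulr_natl natrM.
by rewrite mulfK // M1 mulfV.
Qed.

Lemma sum_rank_apart : \sum_(k < a.+1) \sum_(k' < a.+1) rank_apart R a k k' = 1.
Proof.
rewrite /rank_apart; under eq_bigr do rewrite -mulr_suml big_split /= sumr_const card_ord.
rewrite -mulr_suml big_split /= sum_q sumr_const card_ord -!mulrnA -[(_ - _) *+ _]mulr_natl.
rewrite natrM -M1; move: M_neq0 a_neq0; rewrite -M1; move: (M) => m m0 a0.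
by field; rewrite m0 a0.
Qed.

Let qsum (f : R -> R) : R := \sum_(k < a.+1) \sum_(k' < a.+1) f (q k k').

(** The joint laws [rank_mixed] and [rank_apart] are affine functions of [q], so
    their products are quadratic in [q]. *)
Let qsum_quadratic (u v w : R) :
  qsum (fun t => u + v * t + w * t ^+ 2) = u * M ^+ 2 + v + w * (S2 R a.+1 / M ^+ 2).
Proof.
have hu : u * M ^+ 2 = \sum_(k < a.+1) \sum_(k' < a.+1) u.
  by rewrite !(sumr_const, card_ord) -mulrnA -[RHS]mulr_natr natrM expr2.
have hv : v = \sum_(k < a.+1) \sum_(k' < a.+1) v * q k k'.
  by under eq_bigr do rewrite -mulr_sumr; rewrite -mulr_sumr sum_q mulr1.
have hw : w * (S2 R a.+1 / M ^+ 2) = \sum_(k < a.+1) \sum_(k' < a.+1) w * q k k' ^+ 2.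
  by under eq_bigr do rewrite -mulr_sumr; rewrite -mulr_sumr sum_q_sqr.
rewrite hu [X in _ = _ + X + _]hv hw /qsum -!big_split; apply: eq_bigr => k _ /=.
by rewrite -!big_split.
Qed.

Let gram (f g : nat -> nat -> R) : R :=
  \sum_(r : {ffun 'I_d -> 'I_a.+1}) \sum_(r' : {ffun 'I_d -> 'I_a.+1})
    qprod f r r' * qprod g r r'.

Let gramE (f g : nat -> nat -> R) (u v w X : R) :
  (forall k k', f k k' * g k k' = u + v * q k k' + w * q k k' ^+ 2) ->
  u * M ^+ 4 + v * M ^+ 2 + w * S2 R a.+1 = X -> gram f g = X ^+ d / (M ^+ d) ^+ 2.
Proof.
move=> fg <-; rewrite /gram; under eq_bigr do under eq_bigr do rewrite qprodM.
rewrite sum_qprod exprAC -expr_div_n; congr (_ ^+ d).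
under eq_bigr do under eq_bigr do rewrite fg.
have := qsum_quadratic u v w; rewrite /qsum => ->.
by move: M_neq0; move: (M) => m m0; field; rewrite m0.
Qed.

Lemma lim_varE : 2 * (M ^+ d) ^+ 2 * \sum_r \sum_r' cell_cov r r' ^+ 2 = lim_var R d a.+1.
Proof.
pose s := S2 R a.+1; pose b := rank_mixed R a; pose c := rank_apart R a.
have aM : a%:R = M - 1 :> R by rewrite M1.
have MM := M_neq0; have aa : M - 1 != 0 by rewrite M1.
have AA : gram q q = s ^+ d / (M ^+ d) ^+ 2.
  by apply: (@gramE _ _ 0 0 1) => [k k'|]; rewrite /s; ring.
have AB : gram q b = ((M - s) / (M - 1)) ^+ d / (M ^+ d) ^+ 2.
  apply: (@gramE _ _ 0 (M^-1 / a%:R) (- a%:R^-1)) => [k k'|]; rewrite /b /rank_mixed aM /s;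
  by move: MM aa; move: (M) => m m0 a0; field; rewrite m0 a0.
have AC : gram q c = ((M ^+ 2 - 2 * M + s) / (M - 1) ^+ 2) ^+ d / (M ^+ d) ^+ 2.
  apply: (@gramE _ _ 0 ((1 - 2 / M) / a%:R ^+ 2) (a%:R ^- 2)) => [k k'|];
  rewrite /c /rank_apart aM /s;
  by move: MM aa; move: (M) => m m0 a0; field; rewrite m0 a0.
have BB : gram b b = ((M ^+ 2 - 2 * M + s) / (M - 1) ^+ 2) ^+ d / (M ^+ d) ^+ 2.
  apply: (@gramE _ _ (M ^- 2 / a%:R ^+ 2) (- 2 / M / a%:R ^+ 2) (a%:R ^- 2)) => [k k'|];
  rewrite /b /rank_mixed aM /s;
  by move: MM aa; move: (M) => m m0 a0; field; rewrite m0 a0.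
have BC : gram b c =
    ((M ^+ 3 - 3 * M ^+ 2 + 3 * M - s) / (M - 1) ^+ 3) ^+ d / (M ^+ d) ^+ 2.
  apply: (@gramE _ _ (M^-1 * (1 - 2 / M) / a%:R ^+ 3)
    ((M^-1 - (1 - 2 / M)) / a%:R ^+ 3) (- a%:R ^- 3)) => [k k'|];
  rewrite /b /c /rank_mixed /rank_apart aM /s;
  by move: MM aa; move: (M) => m m0 a0; field; rewrite m0 a0.
have CC : gram c c =
    ((M ^+ 4 - 4 * M ^+ 3 + 6 * M ^+ 2 - 4 * M + s) / (M - 1) ^+ 4) ^+ d / (M ^+ d) ^+ 2.
  apply: (@gramE _ _ ((1 - 2 / M) ^+ 2 / a%:R ^+ 4)
    (2 * (1 - 2 / M) / a%:R ^+ 4) (a%:R ^- 4)) => [k k'|];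
  rewrite /c /rank_apart aM /s;
  by move: MM aa; move: (M) => m m0 a0; field; rewrite m0 a0.
have A1 := sum_qprod q; rewrite sum_q expr1n in A1.
have B1 := sum_qprod b; rewrite sum_rank_mixed expr1n in B1.
have C1 := sum_qprod c; rewrite sum_rank_apart expr1n in C1.
have c4 : \sum_(r : {ffun 'I_d -> 'I_a.+1}) \sum_(r' : {ffun 'I_d -> 'I_a.+1})
    cell_prob R d a ^+ 4 = (M ^+ d) ^+ 2 * cell_prob R d a ^+ 4.
  rewrite !(sumr_const, card_ffun, card_ord) -mulrnA -[LHS]mulr_natl natrM natrX.
  by rewrite expr2.
pose p2 := cell_prob R d a ^+ 2.
pose total f : R := \sum_r \sum_r' qprod f r (r' : {ffun 'I_d -> 'I_a.+1}).
transitivity (2 * (M ^+ d) ^+ 2 * (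
    gram q q + 4 * a%:R * gram q b + 2 * a%:R ^+ 2 * gram q c
  + 4 * a%:R ^+ 2 * gram b b + 4 * a%:R ^+ 3 * gram b c + a%:R ^+ 4 * gram c c
  + - 2 * p2 * total q + - 4 * a%:R * p2 * total b + - 2 * a%:R ^+ 2 * p2 * total c
  + \sum_(r : {ffun 'I_d -> 'I_a.+1}) \sum_(r' : {ffun 'I_d -> 'I_a.+1})
      cell_prob R d a ^+ 4)).
  rewrite /gram /total.
  congr (_ * _); rewrite !mulr_sumr -!big_split; apply: eq_bigr => r _ /=.
  rewrite !mulr_sumr -!big_split; apply: eq_bigr => r' _ /=.
  rewrite /cell_cov /p2 -/b -/c.
  by move: (qprod q r r') (qprod b r r') (qprod c r r') (cell_prob R d a) => A A' A'' p; ring.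
rewrite AA AB AC BB BC CC [total q]A1 [total b]B1 [total c]C1 c4.
rewrite /p2 /cell_prob /lim_var -/s aM.
have : M ^+ d != 0 by rewrite expf_neq0.
move: (_ ^+ d) (_ ^+ d) (_ ^+ d) (_ ^+ d) (_ ^+ d) (_ ^+ d) => t1 t2 t3 t4 t5 t6 t0.
by move: (M) => m; field.
Qed.

End ClosedForms.

(** * Limits of the moments *)

Lemma cvg_dist_le_div (R : realType) (u : nat -> R) (l C : R) (N : nat) :
  (forall n, (N <= n)%N -> `|u n - l| <= C / n%:R) -> (u n @[n --> \oo] --> l)%classic.
Proof.
move=> uC; apply/cvgrPdist_le => /= e e0; near=> n.
have n0 : 0 < n%:R :> R by near: n; exact: nbhs_infty_gtr.
rewrite distrC (le_trans (uC n _)) //; first by near: n; exact: nbhs_infty_ge.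
rewrite ler_pdivrMr // mulrC -ler_pdivrMr //.
by near: n; exact: nbhs_infty_ger.
Unshelve. all: by end_near. Qed.

Section Limits.
Context (R : realType) (d a : nat).
Context (d_gt0 : (0 < d)%N) (a_gt0 : (0 < a)%N).
Context (x : forall n, 'I_n -> d.-tuple R) (xI : forall n, no_ties (@x n)).
Notation cell_cov := (@cell_cov R d a).
Notation M := (a.+1%:R : R).
Implicit Types (r : {ffun 'I_d -> 'I_a.+1}).

Lemma inter_moment2_le n : (a.+1 <= n)%N ->
  inter_moment2 R n a.+1 <= 2 * ((a.+1 * a) ^ 2)%:R / n%:R ^+ 2.
Proof.
move=> an; have n1 : (1 < n)%N by apply: leq_trans an.
have n0 : 0 < n%:R :> R by rewrite ltr0n ltnW.
have n10 : 0 < n.-1%:R :> R by rewrite ltr0n; case: (n) n1 => [|[]].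
rewrite /inter_moment2 [leRHS]mulrAC [leLHS]mulrC ler_wpM2r ?ler0n //.
rewrite ler_pdivlMr ?exprn_gt0 // ler_pdivrMl ?natrM ?mulr_gt0 //.
by rewrite -natrX -!natrM ler_nat; nia.
Qed.

Lemma norm_sum_le (I : finType) (f g : I -> R) :
  (forall i, `|f i| <= g i) -> `|\sum_i f i| <= \sum_i g i.
Proof.
move=> fg; apply: le_trans (ler_norm_sum _ _ _) _.
by apply: ler_sum => i _; exact: fg.
Qed.

Let c : R := M ^+ d / M ^+ 2.
Let c_ge0 : 0 <= c. Proof. by rewrite divr_ge0 ?exprn_ge0 ?ler0n. Qed.
Let cE : M ^+ d = c * M ^+ 2.
Proof. by rewrite /c divfK // expf_neq0 // pnatr_eq0. Qed.

Let n_gt0 n : (a.+1 <= n)%N -> 0 < n%:R :> R.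
Proof. by move=> an; rewrite ltr0n; exact: leq_trans an. Qed.

Let n_mu n : (a.+1 <= n)%N -> n%:R * inter_moment1 R n a.+1 = M ^+ 2.
Proof. by move=> an; rewrite /inter_moment1 mulrCA mulfV ?mulr1 ?natrX // gt_eqF // n_gt0. Qed.

Lemma mean_cvg : (n%:R * smean (@x n) (@T_indep R d n a) @[n --> \oo] -->
   M ^+ d * \sum_r cell_cov r r)%classic.
Proof.
pose K : R := 2 * ((a.+1 * a) ^ 2)%:R.
apply: (@cvg_dist_le_div _ _ _ (c * \sum_r ((1 + `|cell_cov r r|) * K)) a.+1) => n an.
rewrite (smean_T an) // -/c cE; move: (c) c_ge0 => k k_ge0.
have E (A A' : R) : n%:R * (k * A) - k * M ^+ 2 * A' = k * (n%:R * A - M ^+ 2 * A').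
  by ring.
rewrite E {E}.
rewrite normrM ger0_norm // -mulrA ler_wpM2l //.
rewrite !mulr_sumr -sumrB mulr_suml; apply: norm_sum_le => r.
rewrite -(n_mu an) -mulrA -mulrBr normrM normr_nat.
have := avg_moment2_bound d_gt0 a_gt0 an (@xI n) r r.
rewrite -(ler_pM2l (n_gt0 an)) => /le_trans; apply.
rewrite mulrCA -mulrA ler_wpM2l ?addr_ge0 //.
rewrite -ler_pdivlMl ?n_gt0 // mulrC -mulrA -invfM -expr2; exact: inter_moment2_le.
Qed.

Let D n : R := 36 * inter_moment1 R n a.+1 ^+ 3 +
  6 * (inter_moment1 R n a.+1 * inter_moment2 R n a.+1).
Let KD : R := 36 * M ^+ 6 + 6 * (M ^+ 2 * (2 * ((a.+1 * a) ^ 2)%:R)).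

Let D_le n : (a.+1 <= n)%N -> n%:R ^+ 2 * D n <= KD / n%:R.
Proof.
move=> an; have n0 := n_gt0 an; have mE := n_mu an.
rewrite ler_pdivlMr //.
have -> : n%:R ^+ 2 * D n * n%:R = 36 * (n%:R * inter_moment1 R n a.+1) ^+ 3 +
   6 * ((n%:R * inter_moment1 R n a.+1) * (n%:R ^+ 2 * inter_moment2 R n a.+1)).
  by rewrite /D; ring.
rewrite mE /KD -exprM lerD2l ler_wpM2l // ler_wpM2l ?exprn_ge0 //.
rewrite mulrC -ler_pdivlMr ?exprn_gt0 //; exact: inter_moment2_le.
Qed.

(** The three terms come from the three ways of pairing the four sets which
    carry the cells r, r, r', r'. *)
Lemma second_moment_cvg : (n%:R ^+ 2 * smean (@x n) (fun z => @T_indep R d n a z ^+ 2)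
  @[n --> \oo] --> (M ^+ d) ^+ 2 * \sum_r \sum_r'
    (cell_cov r r * cell_cov r' r' + cell_cov r r' * cell_cov r r' +
     cell_cov r r' * cell_cov r r'))%classic.
Proof.
apply: (@cvg_dist_le_div _ _ _ (c ^+ 2 * \sum_r \sum_r'
  (moment4_const R r r r' (r' : {ffun 'I_d -> 'I_a.+1}) * KD)) a.+1) => n an.
rewrite (smean_T_sqr an) // -/c cE; move: (c) c_ge0 => k k_ge0.
have E (A A' : R) : n%:R ^+ 2 * (k ^+ 2 * A) - (k * M ^+ 2) ^+ 2 * A' =
  k ^+ 2 * (n%:R ^+ 2 * A - (M ^+ 2) ^+ 2 * A') by ring.
rewrite E {E}.
rewrite normrM ger0_norm ?exprn_ge0 // -mulrA ler_wpM2l ?exprn_ge0 //.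
rewrite !mulr_sumr -sumrB mulr_suml; apply: norm_sum_le => r.
rewrite !mulr_sumr -sumrB mulr_suml; apply: norm_sum_le => r'.
have E (t u A A' : R) : t ^+ 2 * A - (t * u) ^+ 2 * A' = t ^+ 2 * (A - u ^+ 2 * A').
  by ring.
rewrite -(n_mu an) E {E} normrM ger0_norm ?exprn_ge0 //.
have := avg_moment4_bound d_gt0 a_gt0 an (@xI n) r r r' r'.
have n20 : 0 < n%:R ^+ 2 :> R by rewrite exprn_gt0 // n_gt0.
rewrite -(ler_pM2l n20) => /le_trans; apply.
rewrite mulrCA -[leRHS]mulrA ler_wpM2l ?moment4_const_ge0 //; exact: D_le.
Qed.

Lemma var_cvg :
  (n%:R ^+ 2 * (smean (@x n) (fun z => @T_indep R d n a z ^+ 2) -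
                smean (@x n) (@T_indep R d n a) ^+ 2)
  @[n --> \oo] --> 2 * (M ^+ d) ^+ 2 * \sum_r \sum_r' cell_cov r r' ^+ 2)%classic.
Proof.
have := mean_cvg; set u := (fun n => _ * _) => cu.
have h2 := @cvgM _ _ \oo%classic _ u u _ _ cu cu.
have h := cvgB second_moment_cvg (h2 _).
have -> : 2 * (M ^+ d) ^+ 2 * \sum_r \sum_r' cell_cov r r' ^+ 2 =
  (M ^+ d) ^+ 2 * \sum_r \sum_r'
    (cell_cov r r * cell_cov r' r' + cell_cov r r' * cell_cov r r' +
     cell_cov r r' * cell_cov r r')
  - (M ^+ d * \sum_r cell_cov r r) * (M ^+ d * \sum_r cell_cov r r).
  have E (t A A' : R) : t ^+ 2 * A - (t * A') * (t * A') = t ^+ 2 * (A - A' * A') by ring.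
  rewrite E {E} [2 * _]mulrC -mulrA; congr (_ * _).
  rewrite [in RHS]mulr_suml mulr_sumr -sumrB; apply: eq_bigr => r _.
  rewrite !mulr_sumr -sumrB; apply: eq_bigr => r' _.
  by move: (cell_cov _ _) (cell_cov _ _) (cell_cov _ _) => p v w; ring.
rewrite (_ : (fun n => _) = (fun n => n%:R ^+ 2 *
  smean (@x n) (fun z => @T_indep R d n a z ^+ 2)) \- (u \* u)); first exact: h.
by apply/funext => n; rewrite /u /=; ring.
Qed.

End Limits.

(** * Expectations as means over shuffles *)

Local Open Scope classical_set_scope.

Section FiniteValued.
Context (dT : measure_display) (T : measurableType dT) (R : realType)
  (P : probability T R).

Lemma expectation_finite (I : finType) (p : T -> I) (g : I -> R) :
  (forall i, measurable (p @^-1` [set i])) ->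
  ('E_P[fun w => g (p w)] = (\sum_i g i * fine (P (p @^-1` [set i])))%:E)%E.
Proof.
move=> mp; pose ind i : T -> R := \1_(p @^-1` [set i]).
have indL i : ind i \in Lfun P 1 by apply/Lfun1_integrable; exact: integrable_indic.
pose X := [seq (g i \o* ind i) | i <- index_enum I].
rewrite (_ : (fun w => g (p w)) = \sum_(f <- X) f); last first.
  apply/funext => w; rewrite /X big_map fct_sumE (bigD1 (p w)) //= big1 ?addr0.
    by rewrite /ind indicE mem_set // mul1r.
  move=> i /eqP ip; rewrite /ind indicE memNset ?mul0r //= => e; exact/ip/esym.
rewrite expectation_sum; last first.
  move=> f /mapP[i _ ->]; apply/Lfun1_integrable.
  rewrite (_ : EFin \o _ = fun w => (g i)%:E * (EFin \o ind i) w)%E; last first.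
    by apply/funext => w; rewrite /= mulrC EFinM.
  by apply: integrableZl => //; exact/Lfun1_integrable.
rewrite /X big_map -sumEFin; apply: eq_bigr => i _.
rewrite expectationZl // expectation_indic // EFinM fineK //.
exact: fin_num_measure.
Qed.

End FiniteValued.

Section TupleLaw.
Context (R : realType) (N : nat).

(** Boxes are stable under intersection and generate the sigma-algebra. *)
Lemma tuple_law_unique (mu nu : {measure set (N.-tuple R) -> \bar R}) :
  (mu [set: _] < +oo)%E ->
  (forall A : 'I_N -> set R, (forall k, measurable (A k)) ->
    mu (\bigcap_k ((@tnth _ R ^~ k) @^-1` A k)) =
    nu (\bigcap_k ((@tnth _ R ^~ k) @^-1` A k))) ->
  forall E, measurable E -> mu E = nu E.
Proof.
move=> mufin munu.
pose G := [set E : set (N.-tuple R) | exists2 A : 'I_N -> set R,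
  (forall k, measurable (A k)) & E = \bigcap_k ((@tnth _ R ^~ k) @^-1` A k)].
have GT : G [set: _].
  exists (fun=> [set: _]) => //; apply/seteqP; split => // t _ k _ //.
apply: (@measure_unique _ _ _ G (fun=> [set: _])) => //.
- apply/seteqP; split.
    apply: smallest_sub; first exact: smallest_sigma_algebra.
    rewrite -classical_sets.bigcup_seq; apply: classical_sets.bigcup_sub => i _ _ [B mB <-].
    apply: sub_sigma_algebra; exists (fun k => if k == i then B else [set: _]).
      by move=> k; case: ifP.
    rewrite classical_sets.setTI; apply/seteqP; split => t /=.
      by move=> tB k _ /=; case: eqP => [->|].
    by move=> /(_ i Logic.I) /=; rewrite eqxx.
  apply: smallest_sub; first exact: sigma_algebra_measurable.
  move=> _ [A mA ->]; apply: fin_bigcap_measurable => // k _.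
  by rewrite -[X in measurable X]classical_sets.setTI; apply: measurable_tnth.
- move=> _ _ [A mA ->] [B mB ->]; exists (fun k => A k `&` B k).
    by move=> k; exact: measurableI.
  by rewrite -classical_sets.bigcapI; apply: eq_bigcapr => k _; rewrite preimage_setI.
- by rewrite classical_sets.bigcup_const //; exists 0%N.
- by move=> _ [A mA ->]; exact: munu.
Qed.

End TupleLaw.

Section Exchangeable.
Context (R : realType) (d : nat).
Context (disp0 : measure_display) (Omega0 : measurableType disp0)
  (P0 : probability Omega0 R) (X : {RV P0 >-> d.-tuple R}).
Context (disp : measure_display) (Omega : measurableType disp)
  (P : probability Omega R) (n : nat) (Y : 'I_n -> {RV P >-> d.-tuple R}).
Context (X_indep : independent_components X) (Y_iid : iid_copies X Y).
Implicit Types (p : {ffun 'I_d -> 'S_n}).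

Lemma measurable_coordinate (i : 'I_n) (l : 'I_d) :
  measurable_fun [set: Omega] (fun w => tnth (Y i w) l).
Proof. exact: measurable_component. Qed.

Lemma rectangle_prob (A : 'I_n -> 'I_d -> set R) :
  (forall i l, measurable (A i l)) ->
  P (\bigcap_i \bigcap_l ((fun w => tnth (Y i w) l) @^-1` A i l)) =
  (\prod_i \prod_l P0 (component X l @^-1` A i l))%E.
Proof.
move=> mA; have [Yind Ylaw] := Y_iid.
pose A' i : set (d.-tuple R) := \bigcap_l ((@tnth _ R ^~ l) @^-1` A i l).
have mA' i : measurable (A' i).
  apply: fin_bigcap_measurable => // l _.
  by rewrite -[X in measurable X]classical_sets.setTI; apply: measurable_tnth.
have := Yind [set: 'I_n]%SET A' (fun i _ => mA' i).
rewrite (_ : \bigcap_(i in [set` [set: 'I_n]%SET]) _ =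
  \bigcap_i \bigcap_l ((fun w => tnth (Y i w) l) @^-1` A i l)); last first.
  apply/seteqP; split => w /= h i _; last by move=> l _; exact: h.
  by move=> l _; apply: (h i) => //=; rewrite inE.
move=> ->; apply: eq_big => [i|i _]; first by rewrite inE.
have := Ylaw i _ (mA' i); rewrite /distribution /pushforward => ->.
have := X_indep (J := [set: 'I_d]%SET) (A := A i) (fun l _ => mA i l).
rewrite (_ : \bigcap_(l in [set` [set: 'I_d]%SET]) _ = X @^-1` A' i); last first.
  apply/seteqP; split => w /= h l; last by move=> _; exact: h.
  by move=> _; apply: (h l); rewrite /= inE.
by move=> ->; apply: eq_bigl => l; rewrite inE.
Qed.

(** All the entries of the shuffled sample, in a single tuple: its law is
    determined by boxes, on which independence can be used. *)
Definition flat p (w : Omega) : #|{: 'I_n * 'I_d}|.-tuple R :=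
  [tuple tnth (permute (Y^~ w) p (enum_val k).1) (enum_val k).2 | k < _].

Lemma measurable_flat p : measurable_fun [set: Omega] (flat p).
Proof.
apply/measurable_fun_tnthP => k.
rewrite (_ : _ \o _ = fun w => tnth (Y (p (enum_val k).2 (enum_val k).1) w) (enum_val k).2).
  exact: measurable_coordinate.
by apply/funext => w; rewrite /= /flat tnth_mktuple tnth_permute.
Qed.

HB.instance Definition _ p :=
  isMeasurableFun.Build _ _ _ _ (flat p) (measurable_flat p).

(** Entries of the same coordinate have the same law, so the probability of a
    box is a product which does not see in which order they are taken. *)
Lemma flat_law p p' E : measurable E -> P (flat p @^-1` E) = P (flat p' @^-1` E).
Proof.
have key q (A : 'I_#|{: 'I_n * 'I_d}| -> set R) : (forall k, measurable (A k)) ->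
    P (flat q @^-1` (\bigcap_k ((@tnth _ R ^~ k) @^-1` A k))) =
    (\prod_l \prod_i P0 (component X l @^-1` A (enum_rank (i, l))))%E.
  move=> mA; transitivity (P (\bigcap_i \bigcap_l ((fun w => tnth (Y i w) l) @^-1`
      A (enum_rank ((q l)^-1%g i, l))))).
    congr (P _); apply/seteqP; split => w /= h.
      move=> i _ l _ /=; have := h (enum_rank ((q l)^-1%g i, l)) Logic.I.
      by rewrite /= /flat tnth_mktuple enum_rankK tnth_permute permKV.
    move=> k _ /=; rewrite /flat tnth_mktuple tnth_permute.
    case kE : (enum_val k) => [i l] /=; have := h (q l i) Logic.I l Logic.I.
    by rewrite /= permK -kE enum_valK.
  rewrite (@rectangle_prob (fun i l => A (enum_rank ((q l)^-1%g i, l)))) //.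
  rewrite exchange_big; apply: eq_bigr => l _.
  rewrite (reindex_inj (@perm_inj _ (q l))); apply: eq_bigr => i _.
  by rewrite permK.
apply: (@tuple_law_unique R _ (distribution P (flat p)) (distribution P (flat p'))).
  exact: (le_lt_trans (probability_le1 P measurableT) (ltry _)).
by move=> A mA; rewrite /= /distribution /pushforward /= !key.
Qed.

End Exchangeable.

Section NoAtoms.
Context (R : realType) (dT : measure_display) (T : measurableType dT)
  (P : probability T R).
Local Open Scope ereal_scope.

(** The mass of an atom would be a jump of the distribution function. *)
Lemma continuous_cdf_atom (V : {RV P >-> R}) (v : R) :
  continuous (cdf V) -> P (V @^-1` [set v]) = 0.
Proof.
move=> V_cont.
have mV (B : set R) : measurable B -> measurable (V @^-1` B).
  by move=> mB; rewrite -[X in measurable X]classical_sets.setTI; exact: measurable_funPT.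
have fP (B : set R) : measurable B -> P (V @^-1` B) \is a fin_num.
  by move=> mB; apply: fin_num_measure; exact: mV.
have le_cdf y : (y < v)%R -> cdf V y <= cdf V v - P (V @^-1` [set v]).
  move=> yv; rewrite leeBrDr ?fP // /cdf /distribution /pushforward.
  rewrite -measureU; [|exact: mV|exact: mV|].
    apply: le_measure; [apply: mem_set|apply: mem_set|].
    - by apply: measurableU; apply: mV.
    - exact: mV.
    - move=> w [] /=; rewrite !in_itv /=; last by move=> ->.
      by move=> /le_trans; apply; exact: ltW.
  apply/seteqP; split => w //= -[]; rewrite in_itv /= => Vy Vv.
  by move: Vy; rewrite Vv leNgt yv.
have cv : cdf V y @[y --> v^'-] --> cdf V v by apply: cvg_at_left_filter; exact: V_cont.
have : cdf V v <= cdf V v - P (V @^-1` [set v]).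
  apply: cvge_le cv; near=> y; apply: le_cdf; near: y; exact: nbhs_left_lt.
have cfin : cdf V v \is a fin_num by exact: fP.
rewrite leeBrDr ?fP // -[leRHS]adde0 leeD2lE // => le0.
by apply/eqP; rewrite eq_le le0 measure_ge0.
Unshelve. all: by end_near. Qed.

Context (U V : {RV P >-> R}).

Definition pairing (w : T) : R * R := (U w, V w).

Lemma measurable_pairing : measurable_fun [set: T] pairing.
Proof. by apply/measurable_fun_pairP; split; exact: measurable_funPT. Qed.

HB.instance Definition _ := isMeasurableFun.Build _ _ _ _ pairing measurable_pairing.

(** The joint law is a product measure, and the sections of the diagonal are
    points, which have measure zero. *)
Lemma independent_neq_ae :
  (forall A B : set R, measurable A -> measurable B ->
     P (U @^-1` A `&` V @^-1` B) = P (U @^-1` A) * P (V @^-1` B)) ->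
  (forall v, P (V @^-1` [set v]) = 0) ->
  measurable [set w | U w = V w] /\ P [set w | U w = V w] = 0.
Proof.
move=> ind atom; pose D : set (R * R) := [set z | z.1 = z.2].
have mD : measurable D.
  have := @measurable_fun_eqr _ _ R [set: R * R] fst snd measurable_fst measurable_snd.
  move=> /(_ measurableT [set true] Logic.I); rewrite classical_sets.setTI.
  by congr measurable; apply/seteqP; split => z /= /eqP.
have DE : [set w | U w = V w] = pairing @^-1` D by [].
split; first by rewrite DE -[X in measurable X]classical_sets.setTI; exact: measurable_pairing.
have := @product_measure_unique _ _ _ _ R (distribution P U) (distribution P V)
  (distribution P (pairing : {mfun T >-> (R * R)%type})).
move=> /(_ ind D mD) /esym; rewrite /distribution /pushforward /= => DP.
apply: etrans DP _.
rewrite /product_measure1 integral0_eq // => u _ /=.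
rewrite (_ : xsection D u = [set u]); first exact: atom.
by apply/seteqP; split => v; rewrite /xsection /= in_setE => /esym.
Qed.

End NoAtoms.

Section Pattern.
Context (R : realType) (d n : nat).
Implicit Types (x : 'I_n -> d.-tuple R) (F : ('I_n -> d.-tuple R) -> R).
Notation patternT := {ffun 'I_d * ('I_n * 'I_n) -> bool}.

(** The order of the observations of each coordinate as a value in a finite
    type; a local function of the sample factors through it, which makes
    expectations finite sums. *)
Definition pattern x : patternT :=
  [ffun t => tnth (x t.2.1) t.1 <= tnth (x t.2.2) t.1].

Definition pattern_fun F (b : patternT) : R :=
  if pselect (exists x, pattern x = b) is left h then F (projT1 (cid h)) else 0.

Lemma pattern_funE F x : local [set: 'I_n]%SET F -> pattern_fun F (pattern x) = F x.
Proof.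
move=> lF; rewrite /pattern_fun; case: pselect => [h|]; last by case; exists x.
case: (cid h) => z /= zx; apply: lF => l i j _ _.
by move/ffunP/(_ (l, (i, j))): zx; rewrite !ffunE.
Qed.

Definition unflat (t : #|{: 'I_n * 'I_d}|.-tuple R) : 'I_n -> d.-tuple R :=
  fun i => [tuple tnth t (enum_rank (i, l)) | l < d].

Lemma measurable_pattern b : measurable [set t | pattern (unflat t) = b].
Proof.
rewrite (_ : [set t | _] = \bigcap_u [set t |
   (tnth t (enum_rank (u.2.1, u.1)) <= tnth t (enum_rank (u.2.2, u.1))) = b u]); last first.
  apply/seteqP; split => t /= h.
    by move=> u _ /=; rewrite -h ffunE !tnth_mktuple.
  by apply/ffunP => u; rewrite ffunE !tnth_mktuple; exact: h.
apply: fin_bigcap_measurable => // u _.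
have := @measurable_fun_ler _ _ R [set: #|{: 'I_n * 'I_d}|.-tuple R] _ _
  (measurable_tnth (enum_rank (u.2.1, u.1))) (measurable_tnth (enum_rank (u.2.2, u.1))).
by move=> /(_ measurableT [set b u] Logic.I); rewrite classical_sets.setTI.
Qed.

Lemma local_permute F p : local [set: 'I_n]%SET F ->
  local [set: 'I_n]%SET (fun x => F (permute x p)).
Proof.
move=> lF x x' xx'; apply: lF => l i j _ _.
by rewrite !tnth_permute; apply: xx'; rewrite inE.
Qed.

(** Any sample without ties would do. *)
Definition grid : 'I_n -> d.-tuple R := fun i => [tuple (i : nat)%:R | l < d].

Lemma no_ties_grid : no_ties grid.
Proof.
move=> l i j; rewrite /coordinate !tnth_mktuple => /eqP.
by rewrite eqr_nat => /eqP /val_inj.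
Qed.

End Pattern.

Section RankLaw.
Context (R : realType) (d : nat).
Context (disp0 : measure_display) (Omega0 : measurableType disp0)
  (P0 : probability Omega0 R) (X : {RV P0 >-> d.-tuple R}).
Context (disp : measure_display) (Omega : measurableType disp)
  (P : probability Omega R) (n : nat) (Y : 'I_n -> {RV P >-> d.-tuple R}).
Context (X_cont : continuous_marginals X) (X_indep : independent_components X)
  (Y_iid : iid_copies X Y).

Lemma ties_null : P [set w | ~ no_ties (Y^~ w)] = 0%E /\
  measurable [set w | ~ no_ties (Y^~ w)].
Proof.
pose E (t : 'I_d * ('I_n * 'I_n)) : set Omega :=
  if t.2.1 == t.2.2 then classical_sets.set0
  else [set w | tnth (Y t.2.1 w) t.1 = tnth (Y t.2.2 w) t.1].
have EP t : measurable (E t) /\ P (E t) = 0%E.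
  rewrite /E; case: eqP => [_|/eqP ij]; first by rewrite measure0.
  case: t ij => l [i j] /= ij.
  apply: (@independent_neq_ae _ _ _ _ (component_RV (Y i) l) (component_RV (Y j) l)).
    move=> A B mA mB; have [Yind _] := Y_iid.
    pose C k := (@tnth _ R ^~ l) @^-1` (if k == i then A else B).
    have mC k : measurable (C k).
      rewrite -[X in measurable X]classical_sets.setTI; apply: measurable_tnth => //.
      by case: ifP.
    have := Yind [set i; j]%SET C (fun k _ => mC k).
    rewrite big_setU1 ?inE //= big_set1 /C eqxx eq_sym (negPf ij) => <-.
    congr (P _); apply/seteqP; split => w /=.
      move=> [wA wB] k /=; rewrite !inE => /orP[/eqP->|/eqP->]; first by rewrite eqxx.
      by rewrite eq_sym (negPf ij).
    move=> h; have := h i; have := h j; rewrite /= !inE !eqxx orbT eq_sym (negPf ij).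
    by move=> /(_ isT) ? /(_ isT).
  move=> v; have [_ Ylaw] := Y_iid.
  have mv : measurable ((@tnth _ R ^~ l) @^-1` [set v] : set (d.-tuple R)).
    by rewrite -[X in measurable X]classical_sets.setTI; apply: measurable_tnth.
  have := Ylaw j _ mv; rewrite /distribution /pushforward /= => e.
  apply: etrans e _.
  exact: (@continuous_cdf_atom R _ _ P0 (component_RV X l) v (@X_cont l)).
have TE : [set w | ~ no_ties (Y^~ w)] = \bigcup_t E t.
  apply/seteqP; split => w /=.
    move=> h; apply: contrapT => no; apply: h => l i j; rewrite /coordinate => e.
    apply: contrapT => /eqP ij; apply: no; exists (l, (i, j)) => //.
    by rewrite /E /= (negPf ij).
  move=> [[l [i j]] _]; rewrite /E /=; case: eqP => // ij /= e yI.
  by apply: ij; apply: (yI l).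
have mT : measurable (\bigcup_t E t).
  by apply: fin_bigcup_measurable => // t _; have [] := EP t.
split; last by rewrite TE.
rewrite TE; apply/eqP; rewrite -measure_le0.
have mE t : [set: 'I_d * ('I_n * 'I_n)] t -> measurable (E t) by have [] := EP t.
have fT : finite_set [set: 'I_d * ('I_n * 'I_n)] by [].
apply: le_trans (content_sub_fsum P fT mE mT (fun w h => h)) _.
by rewrite fsbig1 // => t _; have [_] := EP t.
Qed.

Lemma measure_neq0_ex (A : set Omega) : P A != 0%E -> exists w, A w.
Proof.
by move=> /eqP A0; apply: contrapT => no; apply: A0;
  rewrite (_ : A = classical_sets.set0) ?measure0 //; apply/seteqP; split => w // Aw;
  apply: no; exists w.
Qed.

(** The law of the order is invariant under shuffles, hence [F] may be replaced
    by its mean over shuffles, which takes the same value on all samples without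
    ties. *)
Lemma expectation_local F : local [set: 'I_n]%SET F ->
  ('E_P[fun w => F (Y^~ w)] = (smean (@grid R d n) F)%:E)%E.
Proof.
move=> lF; pose p0 : {ffun 'I_d -> 'S_n} := [ffun=> 1%g].
have permute1 x : permute x p0 = x.
  by apply/funext => i; apply/eq_from_tnth => l; rewrite tnth_permute ffunE perm1.
pose pat p (w : Omega) := pattern (permute (Y^~ w) p).
have patE p b : pat p @^-1` [set b] =
    flat Y p @^-1` [set t | pattern (unflat t) = b].
  rewrite /pat; apply/seteqP; split => w /=; rewrite (_ : unflat _ = permute (Y^~ w) p) //;
  by apply/funext => i; apply/eq_from_tnth => l; rewrite /unflat /flat !tnth_mktuple enum_rankK.
have mpat p b : measurable (pat p @^-1` [set b]).
  rewrite patE -[X in measurable X]classical_sets.setTI.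
  by apply: measurable_flat => //; exact: measurable_pattern.
pose prob b := fine (P (pat p0 @^-1` [set b])).
have probE p b : P (pat p @^-1` [set b]) = P (pat p0 @^-1` [set b]).
  by rewrite !patE; apply: (flat_law X_indep Y_iid); exact: measurable_pattern.
have EF G p : local [set: 'I_n]%SET G ->
    ('E_P[fun w => G (permute (Y^~ w) p)] = (\sum_b pattern_fun G b * prob b)%:E)%E.
  move=> lG; rewrite (_ : (fun w => _) = fun w => pattern_fun G (pat p w)); last first.
    by apply/funext => w; rewrite /pat pattern_funE.
  rewrite (@expectation_finite _ _ _ P _ (pat p) (pattern_fun G) (mpat p)).
  by congr (_%:E); apply: eq_bigr => b _; rewrite probE.
have sum_prob : \sum_b prob b = 1.
  have := EF (fun=> 1) p0 (fun _ _ _ => erefl); rewrite (expectation_cst P 1) => -[->].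
  apply: eq_bigr => b _; have [->|b0] := eqVneq (prob b) 0; first by rewrite mulr0.
  have [|w <-] := @measure_neq0_ex (pat p0 @^-1` [set b]).
    by apply: contraNneq b0; rewrite /prob => ->.
  by rewrite pattern_funE // mul1r.
have EFp p : \sum_b pattern_fun F b * prob b =
    \sum_b pattern_fun (fun x => F (permute x p)) b * prob b.
  apply: EFin_inj; rewrite -(EF _ p lF) -(EF _ p0 (local_permute p lF)).
  by congr ('E_P[_])%E; apply/funext => w; rewrite permute1.
rewrite (_ : (fun w => _) = fun w => F (permute (Y^~ w) p0)); last first.
  by apply/funext => w; rewrite permute1.
rewrite EF //; congr (_%:E).
apply: (mulfI (card_permute_neq0 R d n)).
transitivity (\sum_(p : {ffun 'I_d -> 'S_n}) \sum_b
    pattern_fun (fun x => F (permute x p)) b * prob b).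
  by rewrite -(eq_bigr _ (fun p _ => EFp p)) sumr_const mulr_natl.
rewrite exchange_big /= -[RHS]mulr1 -[X in _ = _ * X]sum_prob mulr_sumr; apply: eq_bigr => b _.
rewrite -mulr_suml; have [->|b0] := eqVneq (prob b) 0; first by rewrite !mulr0.
congr (_ * _).
have [T0 mT] := ties_null.
have [|w [wb wT]] := @measure_neq0_ex (pat p0 @^-1` [set b] `\` [set w | ~ no_ties (Y^~ w)]).
  apply: contraNneq b0 => h; rewrite /prob; apply/eqP; rewrite (_ : P _ = 0%E) //.
  apply/eqP; rewrite -measure_le0.
  apply: le_trans (_ : P ((pat p0 @^-1` [set b] `\` [set w | ~ no_ties (Y^~ w)]) `|`
    [set w | ~ no_ties (Y^~ w)]) <= 0)%E.
    apply: le_measure; [apply: mem_set|apply: mem_set|].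
    - exact: mpat.
    - by apply: measurableU => //; apply: measurableD.
    - move=> w wb; case: (pselect (no_ties (Y^~ w))) => h'; last by right.
      by left; split => //=; apply.
  by rewrite (null_set_setU _ mT h T0) //; apply: measurableD.
have {}wT : no_ties (Y^~ w) by apply: contrapT.
rewrite (smean_const lF (@no_ties_grid R d n) wT) [RHS]mulVKf ?card_permute_neq0 //.
apply: eq_bigr => p _; rewrite -wb /pat permute1.
by rewrite pattern_funE //; exact: local_permute.
Qed.

End RankLaw.

(** * Limits of the mean and variance of the statistic *)

Lemma local_T_stat (R : realType) (d m n : nat) (p : {ffun 'I_d -> 'I_m} -> R) :
  local [set: 'I_n]%SET (T_stat p).
Proof.
move=> x x' xx'; rewrite /T_stat; congr (_ * _); apply: eq_bigr => r _.
congr ((_ - _) ^+ 2); rewrite /Phat; congr (_ * _); apply: eq_bigr => S _.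
apply: (localS (subsetT S) (local_B r)) => l i j _ _.
by apply: xx'; rewrite inE.
Qed.

Lemma smean_sqr_centered (R : realType) (d n : nat) (x : 'I_n -> d.-tuple R) F :
  smean x (fun z => (F z - smean x F) * (F z - smean x F)) =
  smean x (fun z => F z ^+ 2) - smean x F ^+ 2.
Proof.
set e := smean x F.
rewrite (_ : (fun z => _) = fun z => F z ^+ 2 + (- (2 * e) * F z + e ^+ 2)); last first.
  by apply/funext => z; ring.
by rewrite !(smeanD, smeanZ, smean_cst) -/e; ring.
Qed.

Theorem theorem3p3 (R : realType) (d m : nat) (d_ge1 : (1 <= d)%N)
  (m_ge2 : (2 <= m)%N)
  (disp0 : measure_display) (Omega0 : measurableType disp0)
  (P0 : probability Omega0 R) (X : {RV P0 >-> d.-tuple R})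
  (X_cont : continuous_marginals X) (X_indep : independent_components X)
  (disp : nat -> measure_display) (Omega : forall n, measurableType (disp n))
  (P : forall n, probability (Omega n) R)
  (Y : forall n, 'I_n -> {RV (P n) >-> d.-tuple R})
  (Y_sample : forall n, iid_copies X (Y n)) :
  let T (n : nat) (w : Omega n) : R :=
    T_stat (P_c0 (Y m)) (fun i => Y n i w) in
  (((n%:R ^+ 2)%:E * 'V_(P n)[T n])%E @[n --> \oo] --> (lim_var R d m)%:E) /\
  ((n%:R%:E * 'E_(P n)[T n])%E @[n --> \oo] --> (lim_mean R d m)%:E).
Proof.
case: m m_ge2 => [//|a] m_ge2 T.
have a_gt0 : (0 < a)%N by [].
pose Tc n (z : 'I_n -> d.-tuple R) : R := T_indep a z.
(* the reference value P(r, c_0) is itself a mean over shuffles *)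
have TE n : T n = fun w => Tc n (fun i => Y n i w).
  apply/funext => w; congr (T_stat _ _); apply/funext => r; rewrite /P_c0.
  rewrite (expectation_local X_cont X_indep (Y_sample a.+1)
    (localS (subsetT _) (local_B r))) /=.
  rewrite (smean_B d_ge1 r (@no_ties_grid R d a.+1)) //.
  by rewrite cardsT card_ord.
have lT n : local [set: 'I_n]%SET (Tc n) by exact: local_T_stat.
have ET n : ('E_(P n)[T n] = (smean (@grid R d n) (Tc n))%:E)%E.
  by rewrite TE (expectation_local X_cont X_indep (Y_sample n) (lT n)).
have VT n : ('V_(P n)[T n] =
    (smean (@grid R d n) (fun z => Tc n z ^+ 2) - smean (@grid R d n) (Tc n) ^+ 2)%:E)%E.
  rewrite /variance covariance.unlock ET /= TE -smean_sqr_centered.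
  rewrite -(expectation_local X_cont X_indep (Y_sample n)) // => z z' zz'.
  by rewrite (lT n z z').
split.
- rewrite -(lim_varE R d_ge1 a_gt0); under eq_fun do rewrite VT -EFinM.
  apply: cvg_EFin; first by near=> n.
  exact: (var_cvg d_ge1 a_gt0 (@no_ties_grid R d)).
- rewrite -(lim_meanE R d_ge1 a_gt0); under eq_fun do rewrite ET -EFinM.
  apply: cvg_EFin; first by near=> n.
  exact: (mean_cvg d_ge1 a_gt0 (@no_ties_grid R d)).
Unshelve. all: by end_near. Qed.
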